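(* The number $4/9$ is a non-jump for $3$-uniform hypergraphs.
   Context: A $3$-graph is a set of $3$-element subsets (edges) of a finite vertex set; $|H|$ denotes its number of edges. For a family $\mathcal F$ of $3$-graphs, $\operatorname{ex}(n,\mathcal F)$ is the maximum number of edges in an $n$-vertex $3$-graph containing no member of $\mathcal F$ as a subgraph, and the Turán density is $\pi(\mathcal F)=\lim_{n\to\infty}\operatorname{ex}(n,\mathcal F)/\binom n3$. Let $\Pi^{(3)}_\infty$ be the set of all Turán densities $\pi(\mathcal F)$ of non-empty, possibly infinite, families $\mathcal F$ of $3$-graphs. A number $\alpha\in[0,1)$ is a jump for $3$-graphs if there exists $c>0$ with $\Pi^{(3)}_\infty\cap(\alpha,\alpha+c)=\emptyset$; otherwise $\alpha$ is a non-jump. *)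

(* Defs.v *)
From HB Require Import structures.
From mathcomp Require Import all_boot all_order all_algebra.
From mathcomp Require Import all_classical all_reals all_analysis.

Set Implicit Arguments.
Unset Strict Implicit.
Unset Printing Implicit Defensive.

Import Order.TTheory GRing.Theory Num.Theory.
Import numFieldNormedType.Exports.

Local Open Scope classical_set_scope.
Local Open Scope ring_scope.

Definition uniform3 (V : finType) (E : {set {set V}}) : bool :=
  [forall e in E, #|e| == 3%N].

Record threegraph := ThreeGraph {
  vertices : finType;
  edges : {set {set vertices}};
  edges_uniform : uniform3 edges
}.

(* Containment as a not necessarily induced subgraph, up to isomorphism. *)
Definition contains (H F : threegraph) : Prop :=
  exists f : vertices F -> vertices H,
    injective f /\
    forall e : {set vertices F}, e \in edges F -> f @: e \in edges H.

(* Not [set threegraph]: finType is too large for the universe of [set]. *)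
Definition family := threegraph -> Prop.

Definition free (F : family) (H : threegraph) : Prop :=
  forall G : threegraph, F G -> ~ contains H G.

(* Up to isomorphism, the vertex set of an n-vertex 3-graph is 'I_n.  The
   maximum over no 3-graph at all, which occurs when some member of the family
   has no edges and at most n vertices, is 0 by convention. *)
Definition ex (n : nat) (F : family) : nat :=
  \max_(E : {set {set 'I_n}} |
        `[< exists u : uniform3 E, free F (ThreeGraph u) >]) #|E|.

Definition turan_density (R : realType) (F : family) : R :=
  limn (fun n : nat => (ex n F)%:R / 'C(n, 3)%:R : R).

Definition Pi_infty (R : realType) : set R :=
  [set x | exists F : family,
    (exists G : threegraph, F G) /\ x = turan_density R F].

Definition jump (R : realType) (alpha : R) : Prop :=
  exists2 c : R, 0 < c & @Pi_infty R `&` `]alpha, (alpha + c)[ = set0.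

Definition non_jump (R : realType) (alpha : R) : Prop :=
  0 <= alpha < 1 /\ ~ jump alpha.

(* Main.v *)
(* Consider the 3-graph on a vertex 0 and t further vertices, with all edges {0, i, j} and the
   edges of a 3-graph E on [t].  The density of its blow-ups is the maximum over the simplex
   (y, x) of
     F = 3 y (s^2 - sum x_i^2) + 6 sum_(e in E) x_e,   s = sum x_i, y = 1 - s,
   and it is the Turan density of the family of all 3-graphs without a homomorphism to it.
   The weights x_i = 2/(3t), y = 1/3 give F > 4/9 as soon as |E| > t^2/4.  Conversely
   F <= 4/9 + O(delta) for every weighting if E has codegrees at most 5 and any m <= 1/delta
   vertices span at most m - 2 edges: edges with a vertex of weight < delta contribute O(delta),
   and among the at most 1/delta heavy vertices the loss 3 y x_i^2 caused by the missing
   "edges" {0, i, i} outweighs the gain from E.  Random deletion at edge probability 2/t produces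
   such an E with more than t^2/4 edges. *)
From Pilot Require Import Defs.
From mathcomp Require Import all_boot all_order all_algebra.
From mathcomp Require Import all_classical all_reals all_analysis.
From mathcomp Require Import ring lra zify.

Set Implicit Arguments.
Unset Strict Implicit.
Unset Printing Implicit Defensive.

Import Order.TTheory GRing.Theory Num.Theory.
Import numFieldNormedType.Exports.

Local Open Scope ring_scope.

(** * Real inequalities *)

Section RealInequalities.
Variable R : realFieldType.

(* In the coordinates [al] and [r = s / (2 al^2)] of [gain_bound] below, the line
   [al = 3/10 (2 - r)] separates the region where the first bound exceeds [s (1 - s) (1 + s/4)]
   from the region where the second one does. *)
Lemma above_separator (al r : R) : 0 <= al -> al <= 1 / 2 -> 0 <= r -> 2 * al ^+ 2 * r <= 1 / 2 ->
  3 / 10 * (2 - r) <= al ->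
  2 * (1 - 2 * al) <= r * ((1 - 2 * al ^+ 2 * r) * (1 + al ^+ 2 * r / 2)).
Proof.
move=> al0 al1 r0 hs hr.
(* [b] is the value of [r] on the separating line. The right side increases with [r] as long as
   [2 * al ^+ 2 * r <= 1 / 2], so only [r = b] has to be checked. *)
pose b := 2 - 10 / 3 * al.
have hb : b <= r by rewrite /b; lra.
have b0 : 0 <= b by rewrite /b; lra.
have mono : b * ((1 - 2 * al ^+ 2 * b) * (1 + al ^+ 2 * b / 2)) <=
            r * ((1 - 2 * al ^+ 2 * r) * (1 + al ^+ 2 * r / 2)).
  pose p := al ^+ 2 * r; pose q := al ^+ 2 * b.
  have p1 : p <= 1/4 by rewrite /p; lra.
  have q0 : 0 <= q by rewrite /q mulr_ge0 ?sqr_ge0.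
  have qp : q <= p by rewrite /p /q ler_wpM2l ?sqr_ge0.
  rewrite -subr_ge0.
  have -> : r * ((1 - 2 * al ^+ 2 * r) * (1 + al ^+ 2 * r / 2)) -
      b * ((1 - 2 * al ^+ 2 * b) * (1 + al ^+ 2 * b / 2)) =
      (r - b) * (1 - 3/2 * (p + q) - (p ^+ 2 + p * q + q ^+ 2)).
    by rewrite /p /q; field.
  by rewrite mulr_ge0 ?subr_ge0 //; nra.
apply: le_trans mono.
(* Expanded at [r = b], the right side of the claim is [b] minus [al] times this sum, while its left
   side is [b - 2/3 * al]. The maxima of [al * b ^+ 2] and [al * b] are at [al = 1/5] and
   [al = 3/10]. *)
have : al * b ^+ 2 * (3/2) + al ^+ 3 * b ^+ 3 <= 2/3.
  have h1 : al * b ^+ 2 <= 32/90.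
    have : 0 <= (al - 1/5) ^+ 2 * (80/9 - 100/9 * al) by rewrite mulr_ge0 ?sqr_ge0 //; lra.
    rewrite /b; lra.
  have h2 : al * b <= 3/10 by rewrite /b; have := sqr_ge0 (al - 3/10); lra.
  have h3 : 0 <= al * b by rewrite mulr_ge0.
  have -> : al ^+ 3 * b ^+ 3 = (al * b) ^+ 3 by ring.
  have h4 : (al * b) ^+ 3 <= (3/10) ^+ 3 by rewrite lerXn2r // ?nnegrE //; lra.
  lra.
move=> h.
have -> : b * ((1 - 2 * al ^+ 2 * b) * (1 + al ^+ 2 * b / 2)) =
  b - al * (al * b ^+ 2 * (3/2) + al ^+ 3 * b ^+ 3) by field.
have : al * (al * b ^+ 2 * (3 / 2) + al ^+ 3 * b ^+ 3) <= al * (2/3) by rewrite ler_wpM2l.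
have bE : b = 2 - 10 / 3 * al by [].
move: (al * b ^+ 2 * _ + _) => z; lra.
Qed.

(** The one-variable core of [below_separator]: [al ^+ 2] is replaced by its largest value
    [9/100 * (2 - r) ^+ 2], and the squared factor by a linear lower bound. *)
Lemma separator_quintic (r : R) : 1 <= r -> r <= 2 ->
  36/5 * (2 - r) ^+ 2 * (r - 1) * (r ^+ 2 - 1/2) <= r ^+ 2 * (1 - 29/100 * (r * (2 - r) ^+ 2)).
Proof.
move=> r1 r2.
(* The difference has positive Bernstein coefficients on each of three subintervals. *)
have bern l h : l <= r -> r <= h -> forall i, 0 <= (r - l) ^+ i * (h - r) ^+ (5 - i).
  by move=> rl rh i; rewrite mulr_ge0 // exprn_ge0 // subr_ge0.
have [h|/ltW h] := leP r (5/4).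
  have B := bern _ _ r1 h.
  move: (B 0%N) (B 1%N) (B 2%N) (B 3%N) (B 4%N) (B 5%N); rewrite ?subSS ?subn0; lra.
have [h'|/ltW h'] := leP r (3/2).
  have B := bern _ _ h h'.
  move: (B 0%N) (B 1%N) (B 2%N) (B 3%N) (B 4%N) (B 5%N); rewrite ?subSS ?subn0; lra.
have B := bern _ _ h' r2.
move: (B 0%N) (B 1%N) (B 2%N) (B 3%N) (B 4%N) (B 5%N); rewrite ?subSS ?subn0; lra.
Qed.

(** The left side is the second bound of [gain_bound] at [a = b = al], divided by [4 * al ^+ 4]. *)
Lemma below_separator (al r : R) : 0 <= al -> 1 <= r -> al <= 3 / 10 * (2 - r) ->
  80 * al ^+ 2 * (r - 1) * (r ^+ 2 - 1 / 2) <=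
  (r * ((1 - 2 * al ^+ 2 * r) * (1 + al ^+ 2 * r / 2))) ^+ 2.
Proof.
move=> al0 r1 hr.
have r2 : r <= 2 by lra.
have a2 : al ^+ 2 <= 9 / 100 * (2 - r) ^+ 2.
  have -> : 9 / 100 * (2 - r) ^+ 2 = (3 / 10 * (2 - r)) ^+ 2 by field.
  by rewrite lerXn2r // nnegrE; lra.
have h1 : 80 * al ^+ 2 * (r - 1) * (r ^+ 2 - 1 / 2) <=
          36/5 * (2 - r) ^+ 2 * (r - 1) * (r ^+ 2 - 1/2).
  rewrite ler_wpM2r //; first by nra.
  rewrite ler_wpM2r //; lra.
apply: le_trans h1 _; apply: le_trans (separator_quintic r1 r2) _.
rewrite exprMn ler_wpM2l ?sqr_ge0 //.
set p := al ^+ 2 * r.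
have p0 : 0 <= p by rewrite /p mulr_ge0 ?sqr_ge0 //; lra.
have p1 : p <= 9/100 * (r * (2 - r) ^+ 2).
  have -> : 9/100 * (r * (2 - r) ^+ 2) = (9/100 * (2 - r) ^+ 2) * r by ring.
  by rewrite /p ler_wpM2r //; lra.
have p2 : p <= 9/100.
  apply: le_trans p1 _.
  suff : r * (2 - r) ^+ 2 <= 1 by lra.
  have h : r * (2 - r) <= 1 by have := sqr_ge0 (r - 1); lra.
  have : (2 - r) * (r * (2 - r)) <= (2 - r) * 1 by rewrite ler_wpM2l //; lra.
  lra.
have -> : 2 * al ^+ 2 * r = 2 * p by rewrite /p; ring.
have : 1 - 29/9 * p <= ((1 - 2 * p) * (1 + p / 2)) ^+ 2 by nra.
lra.
Qed.

(* Here [a >= b] are the two largest of a family of weights with square sum [s].  With [a + b]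
   fixed, both bounds on [G] are weakest when [a = b]. *)
Lemma gain_bound (a b s G : R) : 0 <= b -> b <= a -> a + b <= 1 ->
  a ^+ 2 + b ^+ 2 <= s -> s <= a -> 0 <= G ->
  G <= 4 * (a * b) * (1 - a - b) ->
  G ^+ 2 <= 40 * (s - a ^+ 2 - b ^+ 2) * (s ^+ 2 - a ^+ 4 - b ^+ 4) ->
  G <= s * ((1 - s) * (1 + s / 4)).
Proof.
move=> b0 ba ab1 As sa G0 B1 B2.
have a0 : 0 <= a by lra.
have a1 : a <= 1 by lra.
have s0 : 0 <= s by nra.
(* For [s >= 1/2] the first bound suffices: [4 * b * (1 - a - b)] is at most [(1 - a) ^+ 2], and
   [z * (1 - z)] decreases from [s] to [a]. *)
have [sb|/ltW sl] := leP (1/2) s.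
  have h1 : 4 * (a * b) * (1 - a - b) <= a * (1 - a) ^+ 2.
    have : 0 <= a * (1 - a - 2 * b) ^+ 2 by rewrite mulr_ge0 ?sqr_ge0.
    nra.
  have h2 : a * (1 - a) ^+ 2 <= a * (1 - a) by nra.
  have h3 : a * (1 - a) <= s * (1 - s) by nra.
  have h4 : s * (1 - s) <= s * ((1 - s) * (1 + s / 4)).
    by rewrite ler_wpM2l //; nra.
  lra.
rewrite leNgt; apply/negP => Gs.
pose al := (a + b) / 2.
have al0 : 0 <= al by rewrite /al; lra.
have q : a * b <= al ^+ 2 by rewrite /al; have := sqr_ge0 (a - b); lra.
have q2 : 2 * al ^+ 2 <= a ^+ 2 + b ^+ 2 by rewrite /al; have := sqr_ge0 (a - b); lra.
have al1 : al <= 1/2 by rewrite /al; lra.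
have h0 : 0 <= (1 - s) * (1 + s / 4) by nra.
have B1' : s * ((1 - s) * (1 + s / 4)) < 4 * al ^+ 2 * (1 - 2 * al).
  apply: lt_le_trans Gs _; apply: le_trans B1 _.
  have -> : 1 - 2 * al = 1 - a - b by rewrite /al; field.
  by rewrite ler_wpM2r //; lra.
have alp : 0 < al.
  rewrite lt_neqAle al0 andbT; apply/eqP => al00; move: B1'.
  rewrite -al00 expr0n /= mulr0 mul0r ltNge mulr_ge0 //.
have a2p : 0 < 2 * al ^+ 2 by rewrite mulr_gt0 // exprn_gt0.
pose r := s / (2 * al ^+ 2).
have sE : s = 2 * al ^+ 2 * r by rewrite /r mulrCA divff ?mulr1 // gt_eqF.
have r1 : 1 <= r by rewrite /r ler_pdivlMr // mul1r; lra.
have hE : (1 - s) * (1 + s / 4) = (1 - 2 * al ^+ 2 * r) * (1 + al ^+ 2 * r / 2).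
  by rewrite sE; field.
have C1 : r * ((1 - 2 * al ^+ 2 * r) * (1 + al ^+ 2 * r / 2)) < 2 * (1 - 2 * al).
  rewrite -hE -(ltr_pM2l a2p) mulrA -sE; apply: lt_le_trans B1' _; lra.
have [hr|/ltW hr] := leP (3/10 * (2 - r)) al.
  have := above_separator al0 al1 (le_trans ler01 r1) _ hr; rewrite -sE => /(_ sl).
  by rewrite leNgt {1}sE C1.
have := below_separator al0 r1 hr; rewrite leNgt => /negP; apply.
have a4p : 0 < 4 * al ^+ 4 by rewrite mulr_gt0 // exprn_gt0.
rewrite -hE -(ltr_pM2l a4p).
have -> : 4 * al ^+ 4 * (r * ((1 - s) * (1 + s / 4))) ^+ 2 = (s * ((1 - s) * (1 + s / 4))) ^+ 2.
  by rewrite {3}sE; ring.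
apply: (@lt_le_trans _ _ (G ^+ 2)).
  by rewrite ltrXn2r ?nnegrE // mulr_ge0.
apply: le_trans B2 _.
have -> : 4 * al ^+ 4 * (80 * al ^+ 2 * (r - 1) * (r ^+ 2 - 1 / 2)) =
  40 * (s - 2 * al ^+ 2) * (s ^+ 2 - 2 * al ^+ 4) by rewrite sE; field.
rewrite -!mulrA ler_wpM2l // ler_pM //.
- lra.
- have : (a ^+ 2 + b ^+ 2) ^+ 2 <= s ^+ 2 by rewrite lerXn2r ?nnegrE // addr_ge0 ?sqr_ge0.
  have : 0 <= a ^+ 2 * b ^+ 2 by rewrite mulr_ge0 ?sqr_ge0.
  lra.
- lra.
have : 2 * al ^+ 4 <= a ^+ 4 + b ^+ 4; last by lra.
have : (2 * al ^+ 2) ^+ 2 <= (a ^+ 2 + b ^+ 2) ^+ 2 by rewrite lerXn2r ?nnegrE ?addr_ge0 ?sqr_ge0 // ltW.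
have := sqr_ge0 (a ^+ 2 - b ^+ 2); lra.
Qed.

(** Here [sg] is the total weight off the vertex 0, and [s] and [G] are the square sum and 4 times
    the edge sum after scaling that weight to 1. The bound on [G] is chosen so that the cubic
    factors through [w ^+ 2 * (1 - w) <= 4/27] with [w = k * sg]. *)
Lemma pattern_cubic_bound (sg s G : R) : 0 <= sg -> sg <= 1 -> 0 <= s -> s < 1 ->
  G <= s * ((1 - s) * (1 + s / 4)) ->
  3 * (1 - sg) * (sg ^+ 2 * (1 - s)) + 3 / 2 * sg ^+ 3 * G <= 4 / 9.
Proof.
move=> g0 g1 s0 s1 hG.
(* The Taylor polynomial of the square root of [1 - s]; the omitted terms are negative, whence
   [1 - s <= k ^+ 2]. *)
pose k := 1 - s / 2 - s ^+ 2 / 8.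
have k0 : 0 < k by rewrite /k; nra.
have k2 : 1 - s <= k ^+ 2.
  by have := exprn_ge0 3 s0; have := exprn_ge0 4 s0; rewrite /k; lra.
have h1 : 3 * (1 - sg) * (sg ^+ 2 * (1 - s)) + 3 / 2 * sg ^+ 3 * G <= 3 * (1 - s) * (sg ^+ 2 * (1 - sg * k)).
  have : 3 / 2 * sg ^+ 3 * G <= 3 / 2 * sg ^+ 3 * (s * ((1 - s) * (1 + s / 4))).
    by rewrite ler_wpM2l // mulr_ge0 ?exprn_ge0 //; lra.
  rewrite /k; lra.
apply: le_trans h1 _.
have h2 : (k * sg) ^+ 2 * (1 - k * sg) <= 4 / 27.
  have w0 : 0 <= k * sg by rewrite mulr_ge0 // ltW.
  set w := k * sg in w0 *.
  have : 0 <= (w - 2/3) ^+ 2 * (w + 1/3) by rewrite mulr_ge0 ?sqr_ge0 //; lra.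
  lra.
rewrite -(ler_pM2l (exprn_gt0 2 k0)).
have -> : k ^+ 2 * (3 * (1 - s) * (sg ^+ 2 * (1 - sg * k))) = 3 * (1 - s) * ((k * sg) ^+ 2 * (1 - k * sg)) by ring.
apply: (@le_trans _ _ (3 * (1 - s) * (4/27))).
  by rewrite ler_wpM2l //; lra.
lra.
Qed.
End RealInequalities.

(** * Weights on sparse 3-graphs *)

Section SparseHypergraphs.
Variable R : realFieldType.
Variable T : finType.
Implicit Types (E : {set {set T}}) (B X e : {set T}) (x f g : T -> R).

(** Cauchy-Schwarz, read off from Lagrange's identity. *)
Lemma sum_mul_sqr_le (I : finType) (P : pred I) (a b : I -> R) :
  (\sum_(i | P i) a i * b i) ^+ 2 <= (\sum_(i | P i) a i ^+ 2) * (\sum_(i | P i) b i ^+ 2).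
Proof.
have : 0 <= \sum_(i | P i) \sum_(j | P j) (a i * b j - a j * b i) ^+ 2.
  by apply: sumr_ge0 => i _; apply: sumr_ge0 => j _; rewrite sqr_ge0.
suff -> : \sum_(i | P i) \sum_(j | P j) (a i * b j - a j * b i) ^+ 2 =
  2 * ((\sum_(i | P i) a i ^+ 2) * (\sum_(i | P i) b i ^+ 2) - (\sum_(i | P i) a i * b i) ^+ 2).
  by rewrite pmulr_rge0 // subr_ge0.
pose A := \sum_(i | P i) a i ^+ 2; pose C := \sum_(i | P i) b i ^+ 2.
pose D := \sum_(i | P i) a i * b i.
have H i : \sum_(j | P j) (a i * b j - a j * b i) ^+ 2 = a i ^+ 2 * C + b i ^+ 2 * A - 2 * D * (a i * b i).
  rewrite /A /C /D !mulr_sumr mulr_suml -big_split /= -sumrB; apply: eq_bigr => j _; ring.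
under eq_bigr => i _ do rewrite H.
rewrite sumrB big_split /= -!mulr_suml -mulr_sumr -/A -/C -/D; ring.
Qed.

(* Induction on [#|B|], removing the lightest vertex [v] of [B] other than [i] and [j] and
   replacing [f] by [f - f v]. *)
Lemma sum_min_sparse E B (i j : T) f (m : {set T} -> R) :
  i \in B -> j \in B -> i != j ->
  (forall w, w \in B -> 0 <= f w) ->
  (forall w, w \in B -> w != i -> w != j -> f w <= f i /\ f w <= f j) ->
  (forall X, X \subset B -> i \in X -> j \in X ->
     (#|[set e in E | e \subset X]| + 2 <= #|X|)%N) ->
  (forall e w, e \in E -> e \subset B -> w \in e -> m e <= f w) ->
  \sum_(e in E | e \subset B) m e <= \sum_(w in B | (w != i) && (w != j)) f w.
Proof.
elim: {B}#|B| {-2}B (leqnn #|B|) f m => [|n IH] B cB f m iB jB ij f0 fij sp hm.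
  by move: cB; rewrite leqn0 cards_eq0 => /eqP B0; rewrite B0 inE in iB.
pose C := [pred w | [&& w \in B, w != i & w != j]].
case: (pickP C) => [v0 Cv0|C0]; last first.
  rewrite [leRHS]big_pred0 //.
  have B2 : B = [set i; j].
    apply/setP => w; rewrite !inE; have := C0 w; rewrite /=.
    case: (w =P i) => [->|_]; first by rewrite iB.
    case: (w =P j) => [->|_]; first by rewrite jB.
    by rewrite !andbT.
  have := sp B (subxx _) iB jB; rewrite {2}B2 cards2 ij.
  rewrite -[X in (_ <= X)%N]add0n leq_add2r leqn0 cards_eq0 => /eqP E0.
  rewrite big_pred0 // => e; have := finset.in_set0 e; rewrite -E0 inE.
  by [].
case: (arg_minP f Cv0) => v /and3P[vB vi vj] vmin.
set a := f v.
have a0 : 0 <= a by apply: f0.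
pose B' := B :\ v.
have cB' : (#|B'| <= n)%N by rewrite /B'; move: cB; rewrite (cardsD1 v) vB.
have iB' : i \in B' by rewrite !inE eq_sym vi.
have jB' : j \in B' by rewrite !inE eq_sym vj.
have ge_a w : w \in B -> a <= f w.
  move=> wB; case: (w =P i) => [->|/eqP wi]; first by case: (fij v vB vi vj).
  case: (w =P j) => [->|/eqP wj]; first by case: (fij v vB vi vj).
  by apply: vmin; rewrite /C /= wB wi wj.
have inB w : w \in B' -> w \in B by rewrite inE => /andP[].
have H : \sum_(e in E | e \subset B') (m e - a) <= \sum_(w in B' | (w != i) && (w != j)) (f w - a).
  apply: (IH B' cB' (fun w => f w - a) (fun e => m e - a)) => //.
  - by move=> w /inB wB; rewrite subr_ge0 ge_a.
  - by move=> w /inB wB wi wj; rewrite !lerD2r; apply: fij.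
  - by move=> X XB; apply: sp; apply: fintype.subset_trans XB (subsetDl _ _).
  - by move=> e w eE eB we; rewrite lerD2r; apply: hm => //; apply: fintype.subset_trans eB (subsetDl _ _).
(* Subtracting [a] everywhere lowers the left sum by [a] per edge and the right sum by
   [(#|B| - 2) * a]; sparseness of [B] itself compares the two. *)
have cE : #|[set e in E | e \subset B]|%:R + 2 <= #|B|%:R :> R.
  by rewrite -natrD ler_nat; apply: sp.
have e1 : \sum_(e in E | e \subset B) m e = \sum_(e in E | e \subset B) (m e - a) + #|[set e in E | e \subset B]|%:R * a.
  rewrite sumrB; set s := \sum_(_ in E | _) m _.
  suff -> : \sum_(i0 in E | i0 \subset B) a = #|[set e in E | e \subset B]|%:R * a by rewrite subrK.
  rewrite (eq_bigl (mem [set e in E | e \subset B])); last by move=> e; rewrite /= inE.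
  by rewrite sumr_const mulr_natl.
have e2 : \sum_(e in E | e \subset B) (m e - a) <= \sum_(e in E | e \subset B') (m e - a).
  rewrite (bigID (fun e => v \in e)) /=.
  rewrite -[leRHS]add0r lerD //.
    by apply: sumr_le0 => e /andP[/andP[eE eB] ve]; rewrite subr_le0; apply: hm.
  rewrite [leRHS](eq_bigl (fun e => (e \in E) && (e \subset B) && (v \notin e))) //.
  by move=> e; rewrite subsetD1 andbA.
have e3 : \sum_(w in B | (w != i) && (w != j)) f w =
   a + (\sum_(w in B' | (w != i) && (w != j)) (f w - a) + (#|B|%:R - 3) * a).
  rewrite (bigD1 v) /= ?vB ?vi ?vj // -/a; congr (_ + _).
  rewrite (eq_bigl (fun w => (w \in B') && ((w != i) && (w != j)))); last first.
    by move=> w; rewrite !inE; case: (w != v); rewrite ?andbF ?andbT.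
  rewrite sumrB.
  suff -> : \sum_(w in B' | (w != i) && (w != j)) a = (#|B|%:R - 3) * a by rewrite subrK.
  rewrite (eq_bigl (mem (B' :\ i :\ j))); last by move=> w; rewrite !inE andbC -!andbA; do !bool_congr.
  rewrite sumr_const -[LHS]mulr_natl; congr (_ * _).
  rewrite (cardsD1 v B) vB -/B' (cardsD1 i B') iB' (cardsD1 j (B' :\ i)) in_setD1 jB' eq_sym ij /=.
  by rewrite !natrD; lra.
rewrite e1 e3; move: H e2; have := ler_wpM2r a0 cE; lra.
Qed.

Lemma sum_offdiag B g :
  \sum_(a in B) \sum_(b in B | b != a) g a * g b = (\sum_(a in B) g a) ^+ 2 - \sum_(a in B) g a ^+ 2.
Proof.
rewrite expr2 mulr_suml -sumrB; apply: eq_bigr => a aB.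
rewrite -mulr_sumr (bigD1 a aB) /= mulrDr expr2 [X in _ = X - _]addrC addrK.
by congr (_ * _); apply: eq_bigl => b.
Qed.

Lemma sum_offdiag2 e g : #|e| = 2%N ->
  \sum_(a in e) \sum_(b in e | b != a) g a * g b = 2 * \prod_(v in e) g v.
Proof.
move=> /eqP/cards2P[p [q [pq ->]]].
rewrite sum_offdiag !big_setU1 ?inE //= !big_set1; ring.
Qed.

(* Double counting over ordered pairs: each pair [a, b] is the heavy pair of at most [d] edges. *)
Lemma sum_codegree (d : nat) E B (h : {set T} -> {set T}) g :
  (forall a b, a != b -> (#|[set e in E | (a \in e) && (b \in e)]| <= d)%N) ->
  (forall e, e \in E -> h e \subset e :&: B /\ #|h e| = 2%N) ->
  (forall a, 0 <= g a) ->
  2 * \sum_(e in E) \prod_(v in h e) g v <=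
  d%:R * ((\sum_(a in B) g a) ^+ 2 - \sum_(a in B) g a ^+ 2).
Proof.
move=> cod hh g0; rewrite -sum_offdiag mulr_sumr.
under eq_bigr => e eE do rewrite -sum_offdiag2 ?(proj2 (hh e eE)) //.
have -> : \sum_(e in E) \sum_(a in h e) \sum_(b in h e | b != a) g a * g b =
  \sum_(a in B) \sum_(b in B | b != a) \sum_(e in E | (a \in h e) && (b \in h e)) g a * g b.
  transitivity (\sum_(e in E) \sum_(a in B) \sum_(b in B | b != a)
      (if (a \in h e) && (b \in h e) then g a * g b else 0)).
    apply: eq_bigr => e eE; have [hs _] := hh e eE.
    have hB a : a \in h e -> a \in B by move/(fintype.subsetP hs); rewrite inE => /andP[].
    rewrite [RHS](bigID (fun a => a \in h e)) /= [X in _ = _ + X]big1 ?addr0; last first.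
      by move=> a /andP[_ /negbTE na]; apply: big1 => b _; rewrite na.
    rewrite (eq_bigl (fun a => (a \in B) && (a \in h e))); last first.
      by move=> a; case ha: (a \in h e); rewrite ?andbF ?andbT // hB.
    apply: eq_bigr => a /andP[aB ah].
    rewrite ah /= -big_mkcondr; apply: eq_bigl => b.
    by case hb: (b \in h e); rewrite ?andbF ?andbT ?hB.
  rewrite exchange_big /=; apply: eq_bigr => a aB.
  rewrite exchange_big /=; apply: eq_bigr => b _.
  by rewrite -big_mkcondr.
rewrite mulr_sumr; apply: ler_sum => a aB.
rewrite mulr_sumr; apply: ler_sum => b /andP[bB ba].
rewrite (eq_bigl (mem [set e in E | (a \in h e) && (b \in h e)])); last by move=> e; rewrite /= inE.
rewrite sumr_const -[leLHS]mulr_natl ler_wpM2r ?mulr_ge0 // ler_nat.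
apply: leq_trans (cod a b _); last by rewrite eq_sym.
apply/subset_leq_card/fintype.subsetP => e; rewrite !inE => /and3P[eE ae be].
have [/fintype.subsetP hs _] := hh e eE.
by move: (hs _ ae) (hs _ be); rewrite !inE eE => /andP[-> _] /andP[-> _].
Qed.

(** The product over an edge is split into its lightest weight, which sparseness controls, and the
    product over its two other vertices, which the codegrees control. [None] occurs only for the
    empty set. *)
Definition lightest x e : option T := [pick v in e | [forall w in e, x v <= x w]].

Definition heavy x e : {set T} := if lightest x e is Some v then e :\ v else e.
Definition lightw x e : R := if lightest x e is Some v then x v else 0.

Lemma lightestP x e : #|e| = 3%N -> exists v, [/\ lightest x e = Some v, v \in e & forall w, w \in e -> x v <= x w].
Proof.
move=> e3; have /card_gt0P[v0 v0e] : (0 < #|e|)%N by rewrite e3.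
rewrite /lightest; case: pickP => [v /andP[ve /forall_inP h]|h]; first by exists v.
case: (@arg_minP _ _ _ v0 (mem e) x v0e) => v ve hv.
by have := h v; rewrite [v \in e]ve /= => /forall_inP[]; exact: hv.
Qed.

Lemma lightwP x e w : #|e| = 3%N -> w \in e -> lightw x e <= x w.
Proof. by move=> /(lightestP x)[v [hv ve vm]] we; rewrite /lightw hv vm. Qed.

Lemma card_heavy x e : #|e| = 3%N -> heavy x e \subset e /\ #|heavy x e| = 2%N.
Proof.
move=> e3; have [v [hv ve _]] := lightestP x e3; rewrite /heavy hv subD1set; split=> //.
by move: e3; rewrite (cardsD1 v) ve => -[].
Qed.

Lemma prod_heavy x e : #|e| = 3%N -> \prod_(v in e) x v = lightw x e * \prod_(v in heavy x e) x v.
Proof.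
move=> e3; have [v [hv ve _]] := lightestP x e3; rewrite /heavy /lightw hv.
by rewrite (big_setD1 v).
Qed.

(** Sets with fewer than two vertices are excluded because no edge count could satisfy the
    inequality for them. *)
Definition sparse_on (k : nat) E := forall X, (1 < #|X| <= k)%N ->
  (#|[set e in E | e \subset X]| + 2 <= #|X|)%N.

Definition codegree_le (d : nat) E := forall a b, a != b ->
  (#|[set e in E | (a \in e) && (b \in e)]| <= d)%N.

(** * Two bounds on the edge sum inside a small set with heaviest vertices [i] and [j] *)

Section Heavy.
Variables (k d : nat) (E : {set {set T}}) (x : T -> R) (B : {set T}) (i j : T).
Hypothesis E3 : forall e, e \in E -> #|e| = 3%N.
Hypothesis Esp : sparse_on k E.
Hypothesis Ecod : codegree_le d E.
Hypothesis x0 : forall v, 0 <= x v.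
Hypothesis Bk : (#|B| <= k)%N.
Hypothesis iB : i \in B.
Hypothesis jB : j \in B.
Hypothesis ij : i != j.
Hypothesis top : forall w, w \in B -> w != i -> w != j -> x w <= x i /\ x w <= x j.

Let sparse_top X : X \subset B -> i \in X -> j \in X ->
  (#|[set e in E | e \subset X]| + 2 <= #|X|)%N.
Proof.
move=> XB iX jX; apply: Esp; rewrite (leq_trans (subset_leq_card XB) Bk) andbT.
by rewrite (cardD1 i) iX (cardD1 j) !inE eq_sym ij jX.
Qed.

Let sum_top (f : T -> R) :
  \sum_(w in B | (w != i) && (w != j)) f w = \sum_(w in B) f w - f i - f j.
Proof.
rewrite [X in _ = X - _ - _](bigD1 i) //= [X in _ = _ + X - _ - _](bigD1 j) /=; last by rewrite jB eq_sym ij.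
under [X in _ = _ + (_ + X) - _ - _]eq_bigl => w do rewrite -andbA.
by rewrite [f i + _]addrC addrK [f j + _]addrC addrK.
Qed.

(** The two heavier vertices of an edge have product at most [x i * x j], and [sum_min_sparse]
    bounds the sum of the lightest weights. *)
Lemma heavy_sum1 : \sum_(e in E | e \subset B) \prod_(v in e) x v <=
  x i * x j * (\sum_(v in B) x v - x i - x j).
Proof.
have H : \sum_(e in E | e \subset B) lightw x e <= \sum_(w in B | (w != i) && (w != j)) x w.
  apply: (sum_min_sparse iB jB ij) => //.
  by move=> e w eE _; apply: lightwP; apply: E3.
rewrite sum_top in H.
apply: le_trans (ler_wpM2l _ H); last by rewrite mulr_ge0.
rewrite mulr_sumr; apply: ler_sum => e /andP[eE eB].
rewrite (prod_heavy x (E3 eE)) mulrC.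
have [hs /eqP/cards2P[p [q [pq hE]]]] := card_heavy x (E3 eE).
have [v [hv ve vm]] := lightestP x (E3 eE).
apply: ler_wpM2r; first by rewrite /lightw hv.
rewrite hE big_setU1 ?inE //= big_set1.
have pB : p \in B by apply: (fintype.subsetP eB); apply: (fintype.subsetP hs); rewrite hE !inE eqxx.
have qB : q \in B by apply: (fintype.subsetP eB); apply: (fintype.subsetP hs); rewrite hE !inE eqxx orbT.
have top1 w : w \in B -> w != i -> x w <= x j.
  by move=> wB wi; case: (w =P j) => [->|/eqP wj] //; case: (top wB wi wj).
have top2 w : w \in B -> w != j -> x w <= x i.
  by move=> wB wi; case: (w =P i) => [->|/eqP wj] //; case: (top wB wj wi).
case: (p =P i) => [pi|/eqP pi].
  by rewrite pi ler_wpM2l // top1 // -pi eq_sym.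
case: (q =P i) => [qi|/eqP qi].
  by rewrite qi mulrC ler_wpM2l // top1.
case: (p =P j) => [pj|/eqP pj].
  by rewrite pj mulrC ler_wpM2r // top2 // -pj eq_sym.
by apply: ler_pM => //; [apply: top2 | apply: top1].
Qed.

(** Cauchy-Schwarz separates lightest weights from heavy pairs. [sum_min_sparse] for squared weights
    bounds the first factor; [sum_codegree] for squared weights bounds the second, keeping only the
    fourth powers at [i] and [j]. *)
Lemma heavy_sum2 : 2 * (\sum_(e in E | e \subset B) \prod_(v in e) x v) ^+ 2 <=
  d%:R * (\sum_(v in B) x v ^+ 2 - x i ^+ 2 - x j ^+ 2) *
  ((\sum_(v in B) x v ^+ 2) ^+ 2 - x i ^+ 4 - x j ^+ 4).
Proof.
pose F := [set e in E | e \subset B].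
have FP (f : {set T} -> R) : \sum_(e in E | e \subset B) f e = \sum_(e in F) f e.
  by apply: eq_bigl => e; rewrite inE.
have FE e : e \in F -> e \in E /\ e \subset B by rewrite inE => /andP[].
rewrite FP (eq_bigr (fun e => lightw x e * \prod_(v in heavy x e) x v)); last first.
  by move=> e /FE[eE _]; apply: prod_heavy; apply: E3.
have H1 : \sum_(e in F) lightw x e ^+ 2 <= \sum_(v in B) x v ^+ 2 - x i ^+ 2 - x j ^+ 2.
  rewrite -FP -(sum_top (fun v => x v ^+ 2)).
  apply: (sum_min_sparse iB jB ij) => //.
  - by move=> w _; rewrite sqr_ge0.
  - by move=> w wB wi wj; have [h1 h2] := top wB wi wj; rewrite !lerXn2r ?nnegrE.
  move=> e w eE _ we.
  have l0 : 0 <= lightw x e by have [v [hv _ _]] := lightestP x (E3 eE); rewrite /lightw hv.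
  by rewrite lerXn2r ?nnegrE //; apply: lightwP => //; apply: E3.
have H2 : 2 * \sum_(e in F) (\prod_(v in heavy x e) x v) ^+ 2 <=
    d%:R * ((\sum_(v in B) x v ^+ 2) ^+ 2 - \sum_(v in B) (x v ^+ 2) ^+ 2).
  under eq_bigr => e _ do rewrite -prodrXl.
  apply: (@sum_codegree d F B (heavy x) (fun v => x v ^+ 2)).
  - move=> a b ab; apply: leq_trans (Ecod ab); apply/subset_leq_card/fintype.subsetP => e.
    by rewrite !inE => /andP[/andP[-> _] ->].
  - move=> e /FE[eE eB]; have [h1 h2] := card_heavy x (E3 eE); split=> //.
    by rewrite finset.subsetI h1 (fintype.subset_trans h1).
  - by move=> a; rewrite sqr_ge0.
have H3 : x i ^+ 4 + x j ^+ 4 <= \sum_(v in B) (x v ^+ 2) ^+ 2.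
  rewrite (bigD1 i) //= (bigD1 j) /=; last by rewrite jB eq_sym ij.
  rewrite addrA -!exprM lerDl sumr_ge0 // => v _; exact: sqr_ge0.
apply: le_trans (ler_wpM2l _ (sum_mul_sqr_le _ _ _)) _ => //.
have A0 : 0 <= \sum_(e in F) lightw x e ^+ 2 by apply: sumr_ge0 => e _; exact: sqr_ge0.
have C0 : 0 <= \sum_(e in F) (\prod_(v in heavy x e) x v) ^+ 2.
  by apply: sumr_ge0 => e _; exact: sqr_ge0.
rewrite mulrCA mulrA [X in _ <= X]mulrAC [X in _ <= X]mulrC.
rewrite -mulrA; apply: ler_pM => //; first by rewrite mulr_ge0.
apply: le_trans H2 _; apply: ler_wpM2l => //; lra.
Qed.

End Heavy.

(** At most [k] vertices have weight at least [delta], so sparseness applies to the set [B] of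
    these. Edges leaving [B] cost [15 * delta]; inside [B], [gain_bound] and [pattern_cubic_bound]
    apply after scaling by [sg]. *)
Lemma sparse_pattern_bound (k : nat) (delta : R) E x :
  (forall e, e \in E -> #|e| = 3%N) -> sparse_on k E -> codegree_le 5 E ->
  (forall v, 0 <= x v) -> \sum_v x v <= 1 -> 0 < delta -> 1 <= k%:R * delta ->
  3 * (1 - \sum_v x v) * ((\sum_v x v) ^+ 2 - \sum_v x v ^+ 2) +
    6 * \sum_(e in E) \prod_(v in e) x v <= 4 / 9 + 15 * delta.
Proof.
move=> E3 Esp Ecod x0 sg1 d0 kd.
set sg := \sum_v x v in sg1 *.
pose B := [set v | delta <= x v].
have sg0 : 0 <= sg by apply: sumr_ge0.
have sBle (f : T -> R) : (forall v, 0 <= f v) -> \sum_(v in B) f v <= \sum_v f v.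
  by move=> f0; rewrite [leRHS](bigID (mem B)) /= lerDl sumr_ge0.
have Bk : (#|B| <= k)%N.
  rewrite -(ler_nat R) -(ler_pM2r d0); apply: le_trans kd; apply: le_trans sg1.
  apply: le_trans (sBle _ x0); rewrite mulr_natl -sumr_const.
  by apply: ler_sum => v; rewrite inE.
(* Such an edge has lightest weight below [delta], and the products over heavy pairs sum to at most
   5/2 by the codegree bound. *)
have light : 6 * \sum_(e in E | ~~ (e \subset B)) \prod_(v in e) x v <= 15 * delta.
  have H : 2 * \sum_(e in E) \prod_(v in heavy x e) x v <= 5.
    have hh e : e \in E -> heavy x e \subset e :&: finset.setT /\ #|heavy x e| = 2%N.
      by move=> eE; have := card_heavy x (E3 e eE); rewrite finset.setIT.
    have := @sum_codegree 5 E finset.setT (heavy x) x Ecod hh x0.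
    have -> : \sum_(v in finset.setT) x v = sg by apply: eq_bigl => v; rewrite inE.
    have : sg ^+ 2 <= 1 by rewrite expr_le1.
    have : 0 <= \sum_(a in finset.setT) x a ^+ 2 by apply: sumr_ge0 => v _; exact: sqr_ge0.
    lra.
  suff : \sum_(e in E | ~~ (e \subset B)) \prod_(v in e) x v <=
      delta * \sum_(e in E) \prod_(v in heavy x e) x v.
    move=> h; have := ler_wpM2l (ltW d0) H; lra.
  rewrite mulr_sumr [leRHS](bigID (fun e => e \subset B)) /=.
  rewrite -[leLHS]add0r lerD //.
    by apply: sumr_ge0 => e _; rewrite mulr_ge0 ?(ltW d0) // prodr_ge0.
  apply: ler_sum => e /andP[eE /subsetPn[w we wB]].
  rewrite (prod_heavy x (E3 e eE)) ler_wpM2r ?prodr_ge0 //.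
  apply: le_trans (lightwP x (E3 e eE) we) _.
  by move: wB; rewrite inE -ltNge => /ltW.
pose W := \sum_(e in E | e \subset B) \prod_(v in e) x v.
have W0 : 0 <= W by apply: sumr_ge0 => e _; apply: prodr_ge0.
have EW : \sum_(e in E) \prod_(v in e) x v = W + \sum_(e in E | ~~ (e \subset B)) \prod_(v in e) x v.
  by rewrite (bigID (fun e => e \subset B)).
rewrite EW.
pose S := \sum_(v in B) x v ^+ 2.
have S0 : 0 <= S by apply: sumr_ge0 => v _; exact: sqr_ge0.
have SB : S <= \sum_v x v ^+ 2 by apply: sBle => v; exact: sqr_ge0.
suff main : 3 * (1 - sg) * (sg ^+ 2 - S) + 6 * W <= 4 / 9.
  have : 3 * (1 - sg) * (sg ^+ 2 - \sum_v x v ^+ 2) <= 3 * (1 - sg) * (sg ^+ 2 - S).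
    by rewrite ler_wpM2l ?lerD2l ?lerN2 // mulr_ge0 // subr_ge0.
  lra.
(* With at most one vertex in [B] no edge lies inside it, and the bound is the cubic estimate at
   [s = G = 0]. *)
have [B1|B1] := leqP #|B| 1.
  have -> : W = 0.
    rewrite /W big_pred0 // => e; apply/negP => /andP[eE /subset_leq_card].
    by rewrite (E3 _ eE) leqNgt ltnS (leq_trans B1).
  have := @pattern_cubic_bound R sg 0 0 sg0 sg1 (lexx _) ltr01.
  rewrite mul0r !mulr0 subr0 => /(_ (lexx _)).
  have : 0 <= 3 * (1 - sg) * S by rewrite !mulr_ge0 // subr_ge0.
  lra.
have [v0 v0B] : exists v, v \in B by apply/card_gt0P; apply: ltn_trans B1.
have heaviest (A : {set T}) v : v \in A -> exists2 w, w \in A & forall w', w' \in A -> x w' <= x w.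
  by move=> vA; case: (@arg_maxP _ _ _ v (mem A) x vA) => w wA wmax; exists w.
have [i iB imax] := heaviest _ _ v0B.
have [v1 v1B] : exists v, v \in B :\ i.
  by apply/card_gt0P; move: B1; rewrite (cardsD1 i) iB.
have [j /setD1P[ji jB] jmax] := heaviest _ _ v1B.
have ij : i != j by rewrite eq_sym.
have top w : w \in B -> w != i -> w != j -> x w <= x i /\ x w <= x j.
  move=> wB wi wj; split; first exact: imax.
  by apply: jmax; apply/setD1P.
have W1 := heavy_sum1 E3 Esp x0 Bk iB jB ij top.
have W2 := heavy_sum2 E3 Esp Ecod x0 Bk iB jB ij top.
rewrite -/W -/S in W1 W2.
have xi0 : 0 < x i by apply: lt_le_trans d0 _; move: iB; rewrite /= inE.
have xj0 : 0 < x j by apply: lt_le_trans d0 _; move: jB; rewrite /= inE.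
have sB := sBle _ x0.
have sgB : x i + x j <= \sum_(v in B) x v.
  rewrite (bigD1 i) //= (bigD1 j) /=; last by rewrite jB ji.
  by rewrite addrA lerDl sumr_ge0.
have sij : x i + x j <= sg by apply: le_trans sB.
have sgp : 0 < sg by apply: lt_le_trans sij; rewrite addr_gt0.
have sgn : sg != 0 by rewrite gt_eqF.
have SA : x i ^+ 2 + x j ^+ 2 <= S.
  rewrite /S (bigD1 i) //= (bigD1 j) /=; last by rewrite jB ji.
  by rewrite addrA lerDl sumr_ge0 // => v _; exact: sqr_ge0.
have SI : S <= x i * sg.
  apply: (@le_trans _ _ (x i * \sum_(v in B) x v)); last by rewrite ler_wpM2l // ltW.
  by rewrite mulr_sumr; apply: ler_sum => v vB; rewrite expr2 ler_wpM2r // imax.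
(* Scaling to total weight 1; with the factor 4 in [G], the term [6 * W] becomes
   [3 / 2 * sg ^+ 3 * G]. *)
pose a := x i / sg; pose b := x j / sg; pose s := S / sg ^+ 2; pose G := 4 * W / sg ^+ 3.
have xiE : x i = a * sg by rewrite /a divfK.
have xjE : x j = b * sg by rewrite /b divfK.
have SE : S = s * sg ^+ 2 by rewrite /s divfK // expf_neq0.
have WE : W = G / 4 * sg ^+ 3 by rewrite /G; field; rewrite sgn.
have sg2 : 0 < sg ^+ 2 by rewrite exprn_gt0.
have sg3 : 0 < sg ^+ 3 by rewrite exprn_gt0.
have a0 : 0 < a by rewrite divr_gt0.
have b0 : 0 < b by rewrite divr_gt0.
have ab1 : a + b <= 1 by rewrite -mulrDl ler_pdivrMr // mul1r.
have ba : b <= a by rewrite ler_pM2r ?invr_gt0 //; apply: imax.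
have sa : s <= a.
  rewrite -(ler_pM2r sg2) -SE; apply: le_trans SI _; rewrite xiE; lra.
have As : a ^+ 2 + b ^+ 2 <= s.
  by rewrite -(ler_pM2r sg2) -SE mulrDl -!exprMn -xiE -xjE.
have G0 : 0 <= G by rewrite divr_ge0 ?mulr_ge0 // ltW.
have GB1 : G <= 4 * (a * b) * (1 - a - b).
  rewrite -(ler_pM2r sg3).
  have : W <= x i * x j * (sg - x i - x j).
    by apply: le_trans W1 _; rewrite ler_wpM2l ?mulr_ge0 // !lerD2r.
  rewrite WE xiE xjE; lra.
(* The constant is [4 ^+ 2 * 5 / 2], with 5 the codegree bound. *)
have GB2 : G ^+ 2 <= 40 * (s - a ^+ 2 - b ^+ 2) * (s ^+ 2 - a ^+ 4 - b ^+ 4).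
  have sg6 : 0 < sg ^+ 6 by rewrite exprn_gt0.
  rewrite -(ler_pM2r sg6); move: W2; rewrite SE WE xiE xjE; lra.
have GT := gain_bound (ltW b0) ba ab1 As sa G0 GB1 GB2.
have s1 : s < 1 by lra.
have s0 : 0 <= s by rewrite divr_ge0 // ltW.
have := pattern_cubic_bound sg0 sg1 s0 s1 GT.
by rewrite SE WE; lra.
Qed.

End SparseHypergraphs.
(** * Existence of sparse 3-graphs *)

Section Deletion.
Variable U : finType.

(** One element is removed from each bad set inside [A]; nonemptiness of the bad sets makes this
    possible. *)
Lemma deletion (A : {set U}) (bad : {set {set U}}) : finset.set0 \notin bad ->
  exists E : {set U}, [/\ E \subset A, forall J, J \in bad -> ~~ (J \subset E) &
    (#|A| <= #|E| + #|[set J in bad | J \subset A]|)%N].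
Proof.
move=> bad0; pose BA := [set J in bad | J \subset A].
pose D : {set U} := \bigcup_(J in BA) (if [pick e in J] is Some e then [set e] else finset.set0).
have cD : (#|D| <= #|BA|)%N.
  rewrite /D -[leqRHS]sum1_card; elim/big_rec2: _ => [|J n X _ h]; first by rewrite cards0.
  rewrite (leq_trans (leq_card_setU _ _)) // leq_add //.
  by case: pickP => [e _|_]; rewrite ?cards1 ?cards0.
exists (A :\: D); split; first exact: subsetDl.
  move=> J Jb; apply/negP => JE.
  have JA : J \in BA by rewrite inE Jb (fintype.subset_trans JE) ?subsetDl.
  have [e eJ he] : exists2 e, e \in J & [pick e in J] = Some e.
    case: pickP => [e eJ|J0]; first by exists e.
    by case/negP: bad0; rewrite (_ : finset.set0 = J) //; apply/setP => e; rewrite inE [RHS]J0.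
  have := fintype.subsetP JE e eJ; rewrite inE => /andP[/negP[]].
  by apply/bigcupP; exists J => //; rewrite he inE.
rewrite -/BA (leq_trans _ (leq_add (leqnn _) cD)) //.
by rewrite -{1}(cardsID D A) addnC leq_add2l subset_leq_card // subsetIr.
Qed.

(** A uniformly random [w] models independent choices, [e] being kept when [w e] is 0. Thus all of
    [J] is kept with probability [(M + 1) ^ (- #|J|)]. *)
Lemma card_zero_on (M : nat) (J : {set U}) :
  (#|[set w : {ffun U -> 'I_M.+1} | [forall e in J, w e == ord0]]| * M.+1 ^ #|J| =
   #|{ffun U -> 'I_M.+1}|)%N.
Proof.
pose F e : pred 'I_M.+1 := if e \in J then pred1 ord0 else predT.
have -> : #|[set w : {ffun U -> 'I_M.+1} | [forall e in J, w e == ord0]]| = #|family F|.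
  rewrite cardsE; apply: eq_card => w; rewrite !inE; apply/forall_inP/familyP => h e.
    by rewrite /F; case: ifP => // /h /eqP ->; rewrite inE.
  by move=> eJ; have := h e; rewrite /F eJ inE.
rewrite card_family card_ffun card_ord foldrE big_map big_enum /=.
rewrite (bigID (mem J)) /= big1 ?mul1n; last by move=> e eJ; rewrite /F eJ card1.
under eq_bigr => e eJ do rewrite /F (negbTE eJ) cardT size_enum_ord.
rewrite prod_nat_const -expnD; congr (_ ^ _)%N.
by rewrite addnC -(cardC (mem J)).
Qed.

(* Keep each element of [A] with probability [1 / (M + 1)], then delete one element of each
   surviving bad set. *)
Lemma random_deletion (M : nat) (A : {set U}) (bad : {set {set U}}) : finset.set0 \notin bad ->
  exists E : {set U}, [/\ E \subset A, forall J, J \in bad -> ~~ (J \subset E) &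
    #|A|%:R / M.+1%:R - \sum_(J in bad) M.+1%:R^-1 ^+ #|J| <= #|E|%:R :> rat].
Proof.
move=> bad0.
pose O := {ffun U -> 'I_M.+1}.
pose S (w : O) := [set e in A | w e == ord0].
pose c := #|A|%:R / M.+1%:R - \sum_(J in bad) M.+1%:R^-1 ^+ #|J| : rat.
(* First moment method: [c] is at most the mean of the right side over [w], because a bad set inside
   [S w] forces [w] to vanish on it. *)
suff [w hw] : exists w : O, c <= #|S w|%:R - #|[set J in bad | J \subset S w]|%:R.
  have [E [ES Eb cE]] := deletion (S w) bad0.
  exists E; split=> //; first by rewrite (fintype.subset_trans ES) //; apply/fintype.subsetP => e; rewrite inE => /andP[].
  apply: le_trans hw _; rewrite lerBlDr -natrD ler_nat; exact: cE.
have P (J : {set U}) : \sum_(w : O) (([forall e in J, w e == ord0] : nat)%:R : rat) = #|O|%:R * M.+1%:R^-1 ^+ #|J|.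
  have M0 : M.+1%:R ^+ #|J| != 0 :> rat by rewrite expf_neq0 // pnatr_eq0.
  rewrite exprVn -(card_zero_on M J) natrM natrX mulfK // -natr_sum; congr (_%:R).
  by rewrite -sum1dep_card -big_mkcond big_mkcond /= [RHS]big_mkcond; apply: eq_bigr => w _; case: ifP.
have sum : \sum_(w : O) (#|S w|%:R - #|[set J in bad | J \subset S w]|%:R) >= #|O|%:R * c.
  rewrite sumrB /c mulrBr lerB //.
    have -> : \sum_(w : O) (#|S w|%:R : rat) = \sum_(e in A) \sum_(w : O) (([forall e' in [set e], w e' == ord0] : nat)%:R : rat).
      rewrite exchange_big /=; apply: eq_bigr => w _.
      rewrite -natr_sum -sum1_card; congr (_%:R).
      rewrite [RHS]big_mkcond /= [LHS]big_mkcond /=; apply: eq_bigr => e _.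
      rewrite !inE; case: (e \in A) => //=.
      have -> : [forall e' in [set e], w e' == ord0] = (w e == ord0).
        apply/forall_inP/idP => [->//|h e']; first by rewrite inE.
        by rewrite inE => /eqP ->.
      by case: (w e == ord0).
    under eq_bigr => e _ do rewrite P cards1 expr1.
    by rewrite sumr_const -[leRHS]mulr_natl mulrCA.
  rewrite mulr_sumr.
  under [leRHS]eq_bigr => J _ do rewrite -P.
  rewrite exchange_big /=; apply: ler_sum => w _.
  rewrite -natr_sum ler_nat -sum1_card.
  rewrite [leqRHS]big_mkcond [leqLHS]big_mkcond /=; apply: leq_sum => J _.
  rewrite inE; case: (J \in bad) => //=.
  case: ifP => // /fintype.subsetP h; rewrite (_ : [forall e in J, w e == ord0]) //.
  by apply/forall_inP => e /h; rewrite inE => /andP[].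
apply/existsP; apply: contraT => /existsPn h.
have O0 : (0 < #|O|)%N by rewrite card_ffun card_ord expn_gt0.
have [w0 _] := card_gt0P O0.
move: sum; rewrite leNgt => /negP[].
have -> : #|O|%:R * c = \sum_(w : O) c by rewrite sumr_const -[RHS]mulr_natl.
apply: ltr_sum => [|w _]; first by apply/hasP; exists w0; rewrite ?mem_index_enum.
by rewrite ltNge h.
Qed.
End Deletion.

(** The union bound for nonnegative weights. *)
Lemma sum_exists_le (I J : finType) (c : I -> pred J) (w : J -> rat) : (forall j, 0 <= w j) ->
  \sum_(j | [exists i, c i j]) w j <= \sum_i \sum_(j | c i j) w j.
Proof.
move=> w0; under [leRHS]eq_bigr => i _ do rewrite big_mkcond /=.
rewrite exchange_big /= big_mkcond /=; apply: ler_sum => j _.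
case: existsP => [[i cij]|_]; last by apply: sumr_ge0 => i _; case: ifP.
by rewrite (bigD1 i) //= cij lerDl sumr_ge0 // => i' _; case: ifP.
Qed.

Lemma bin_fact_le_exp n m : ('C(n, m) * m`! <= n ^ m)%N.
Proof.
rewrite bin_ffact; elim: m => [|m IH] //.
by rewrite ffactnSr expnSr leq_mul // leq_subr.
Qed.

(** * Forbidden configurations and their expected number *)

Section Existence.
Variable T : finType.

Definition triples : {set {set T}} := [set e : {set T} | #|e| == 3%N].

(** Six triples through one pair are the minimal violation of codegree at most 5. *)
Definition star_config (p : {set T}) : pred {set {set T}} :=
  fun J => [&& #|p| == 2%N, #|J| == 6%N & J \subset [set e in triples | p \subset e]].

(** [#|X|.-1] is the least number of edges on [X] that violates [sparse_on]. Members of [J] may be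
    any subsets of [X]: this overcount affects only a constant depending on [k]. *)
Definition dense_config (k : nat) (X : {set T}) : pred {set {set T}} :=
  fun J => [&& (1 < #|X| <= k)%N, #|J| == #|X|.-1 & J \subset powerset X].

Definition bad_configs k : {set {set {set T}}} :=
  [set J | [exists p, star_config p J] || [exists X, dense_config k X J]].

Lemma set0_notin_bad_configs k : finset.set0 \notin bad_configs k.
Proof.
rewrite inE negb_or; apply/andP; split; apply/existsPn => X; rewrite /star_config /dense_config cards0.
  by rewrite andbF.
by case: #|X| => [|[|n]] //=; rewrite andbF.
Qed.

Lemma subset_of_card (U : finType) (A : {set U}) n : (n <= #|A|)%N ->
  exists2 J : {set U}, J \subset A & #|J| = n.
Proof.
move=> nA; have : (0 < #|[set J : {set U} | J \subset A & #|J| == n]|)%N.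
  by rewrite cards_draws bin_gt0.
by case/card_gt0P => J; rewrite inE => /andP[h /eqP c]; exists J.
Qed.

Lemma avoid_sparse k (E : {set {set T}}) : (forall J, J \in bad_configs k -> ~~ (J \subset E)) ->
  sparse_on k E.
Proof.
move=> h X Xk; rewrite leqNgt; apply/negP => cX.
have [J JE cJ] := @subset_of_card _ [set e in E | e \subset X] #|X|.-1 ltac:(lia).
have /negP[] : ~~ (J \subset E).
  apply: h; rewrite inE; apply/orP; right; apply/existsP; exists X.
  rewrite /dense_config Xk cJ eqxx /=; apply/fintype.subsetP => e /(fintype.subsetP JE).
  by rewrite !inE => /andP[].
by apply: fintype.subset_trans JE _; apply/fintype.subsetP => e; rewrite inE => /andP[].
Qed.

Lemma avoid_codegree k (E : {set {set T}}) : E \subset triples ->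
  (forall J, J \in bad_configs k -> ~~ (J \subset E)) -> codegree_le 5 E.
Proof.
move=> E3 h a b ab; rewrite leqNgt; apply/negP => cX.
have [J JE cJ] := subset_of_card cX.
have /negP[] : ~~ (J \subset E).
  apply: h; rewrite inE; apply/orP; left; apply/existsP; exists [set a; b].
  rewrite /star_config cJ cards2 ab /=; apply/fintype.subsetP => e /(fintype.subsetP JE).
  rewrite inE => /andP[eE /andP[ae be]].
  by rewrite inE (fintype.subsetP E3) // finset.subUset !finset.sub1set ae be.
by apply: fintype.subset_trans JE _; apply/fintype.subsetP => e; rewrite inE => /andP[].
Qed.

Variable M : nat.
Hypothesis cT : #|T| = (2 * M.+1)%N.
Let q : rat := M.+1%:R.

(** There are at most [2 * q ^+ 2] pairs, each in at most [2 * q] triples and hence in at most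
    [64 / 720 * q ^+ 6] stars, each of weight [q ^- 6]. *)
Lemma star_weight : \sum_p \sum_(J | star_config p J) q^-1 ^+ #|J| <= 8 / 45 * q ^+ 2.
Proof.
have q0 : 0 < q by rewrite ltr0n.
have -> : \sum_p \sum_(J | star_config p J) q^-1 ^+ #|J| =
  \sum_(p in [set p : {set T} | #|p| == 2%N]) \sum_(J | star_config p J) q^-1 ^+ 6.
  rewrite [LHS](bigID (mem [set p : {set T} | #|p| == 2%N])) /= [X in _ + X]big1 ?addr0.
    by apply: eq_bigr => p _; apply: eq_bigr => J /and3P[_ /eqP -> _].
  by move=> p; rewrite inE => /negbTE p2; rewrite big_pred0 // => J; rewrite /star_config p2.
have H (p : {set T}) : p \in [set p : {set T} | #|p| == 2%N] ->
    \sum_(J | star_config p J) q^-1 ^+ 6 <= 'C(2 * M.+1, 6)%:R * q^-1 ^+ 6.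
  rewrite inE => p2; rewrite sumr_const -[leLHS]mulr_natl ler_wpM2r ?exprn_ge0 ?invr_ge0 ?(ltW q0) //.
  rewrite ler_nat; pose Tp := [set e in triples | p \subset e].
  have cTp : (#|Tp| <= 2 * M.+1)%N.
    rewrite -cT -cardsT; apply: leq_trans (leq_imset_card (fun c => c |: p) _).
    apply/subset_leq_card/fintype.subsetP => e; rewrite !inE => /andP[/eqP e3 pe].
    have : #|e :\: p| == 1%N by rewrite cardsDS // e3 (eqP p2).
    case/cards1P => c ec; apply/imsetP; exists c => //.
    by rewrite -ec finset.setUC -{1}(finset.setIidPr pe) setID.
  apply: leq_trans (leq_bin2l 6 cTp).
  rewrite -cards_draws; apply/subset_leq_card/fintype.subsetP => J.
  by rewrite !inE /star_config => /and3P[_ -> ->].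
apply: le_trans (ler_sum _ H) _.
rewrite sumr_const card_draws cT -[leLHS]mulr_natl.
have b2 : 'C(2 * M.+1, 2)%:R <= 2 * q ^+ 2.
  have := bin_fact_le_exp (2 * M.+1) 2; rewrite -[2`!]/2%N.
  by rewrite -(ler_nat rat) natrM natrX natrM -/q; lra.
have b6 : 'C(2 * M.+1, 6)%:R <= 64 / 720 * q ^+ 6.
  have := bin_fact_le_exp (2 * M.+1) 6.
  rewrite -[6`!]/720%N.
  by rewrite -(ler_nat rat) natrM natrX natrM -/q; lra.
have b0 n : 0 <= 'C(2 * M.+1, n)%:R :> rat by rewrite ler0n.
have key (c2 c6 z : rat) : 0 < z -> 0 <= c2 -> 0 <= c6 -> c2 <= 2 * z ^+ 2 ->
    c6 <= 64 / 720 * z ^+ 6 -> c2 * (c6 * z^-1 ^+ 6) <= 8 / 45 * z ^+ 2.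
  move=> z0 c20 c60 h2 h6; have zi : 0 <= z^-1 ^+ 6 by rewrite exprn_ge0 // invr_ge0 ltW.
  have h : c6 * z^-1 ^+ 6 <= 64 / 720.
    by rewrite exprVn ler_pdivrMr // exprn_gt0.
  have h0 : 0 <= c6 * z^-1 ^+ 6 by rewrite mulr_ge0.
  by have := ler_pM c20 h0 h2 h; lra.
exact: key.
Qed.

Definition dense_const k : rat := \sum_(s < k.+1) (2 ^ s * 2 ^ (2 ^ s))%:R.

(** At most [(2 * q) ^+ s] sets [X] have size [s], each carries at most [2 ^ (2 ^ s)] families, and
    each family has weight [q ^- (s - 1)]: one factor [q] remains. *)
Lemma dense_weight k : \sum_X \sum_(J | dense_config k X J) q^-1 ^+ #|J| <= dense_const k * q.
Proof.
have q0 : 0 < q by rewrite ltr0n.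
have qn : q != 0 by rewrite gt_eqF.
pose h (s : 'I_k.+1) := \sum_(X : {set T} | #|X| == s) \sum_(J | dense_config k X J) q^-1 ^+ #|J|.
have -> : \sum_X \sum_(J | dense_config k X J) q^-1 ^+ #|J| = \sum_s h s.
  rewrite (bigID (fun X : {set T} => (#|X| < k.+1)%N)) /= [X in _ + X]big1 ?addr0; last first.
    move=> X kX; rewrite big_pred0 // => J; rewrite /dense_config.
    by rewrite -[(#|X| <= k)%N]ltnS (negbTE kX) andbF.
  rewrite (partition_big (fun X : {set T} => inord #|X| : 'I_k.+1) predT) //=.
  apply: eq_bigr => s _; rewrite /h; apply: eq_bigl => X.
  apply/andP/eqP => [[Xk /eqP <-]|Xs]; first by rewrite inordK.
  by rewrite Xs ltn_ord; split=> //; apply/eqP/val_inj; rewrite /= inordK.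
rewrite /dense_const mulr_suml; apply: ler_sum => s _.
rewrite /h; case: (ltnP 1 s) => s1; last first.
  rewrite big1 ?mulr_ge0 ?ler0n ?(ltW q0) // => X /eqP Xs; rewrite big_pred0 // => J.
  by rewrite /dense_config Xs ltnNge s1.
have H (X : {set T}) : #|X| == s :> nat ->
    \sum_(J | dense_config k X J) q^-1 ^+ #|J| <= (2 ^ (2 ^ s))%:R * q^-1 ^+ s.-1.
  move=> /eqP Xs.
  rewrite (eq_bigr (fun _ => q^-1 ^+ s.-1)); last by move=> J /and3P[_ /eqP ->]; rewrite Xs.
  rewrite sumr_const -[leLHS]mulr_natl ler_wpM2r ?exprn_ge0 ?invr_ge0 ?(ltW q0) // ler_nat.
  rewrite -Xs -card_powerset -(card_powerset (powerset X)).
  by apply/subset_leq_card/fintype.subsetP => J; rewrite !inE => /and3P[].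
apply: le_trans (ler_sum _ H) _.
rewrite sumr_const -[leLHS]mulr_natl mulrA.
have -> : #|[pred X : {set T} | #|X| == s]| = 'C(2 * M.+1, s).
  by rewrite -cT -card_draws; apply: eq_card => X; rewrite !inE.
have bs : 'C(2 * M.+1, s)%:R <= 2 ^+ s * q ^+ s.
  rewrite -exprMn -[2 * q]natrM -natrX ler_nat.
  by apply: leq_trans (bin_fact_le_exp _ _); rewrite leq_pmulr // fact_gt0.
have qs : q ^+ s * q^-1 ^+ s.-1 = q.
  by rewrite -{1}(ltn_predK s1) exprS -mulrA -exprMn divff // expr1n mulr1.
apply: (@le_trans _ _ (2 ^+ s * q ^+ s * (2 ^ 2 ^ s)%:R * q^-1 ^+ s.-1)).
  by rewrite !ler_wpM2r ?exprn_ge0 ?invr_ge0 ?ler0n ?(ltW q0).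
rewrite natrM !natrX -[X in _ <= _ * X]qs.
move: (2 ^+ s) (q ^+ s) (2 ^+ (2 ^ s)) (q^-1 ^+ s.-1) => A B C D; lra.
Qed.

(** Triples are kept with probability [1 / q = 2 / #|T|]. About [4/3 * q ^+ 2] are expected, and
    deletion costs at most [8/45 * q ^+ 2] up to linear terms. What remains exceeds
    [q ^+ 2 = #|T| ^ 2 / 4]. *)
Lemma sparse_subset k : 10 * (dense_const k + 2) < q ->
  exists E : {set {set T}}, [/\ forall e, e \in E -> #|e| = 3%N, sparse_on k E, codegree_le 5 E &
    (#|T| ^ 2 < 4 * #|E|)%N].
Proof.
move=> qk.
have q0 : 0 < q by rewrite ltr0n.
have qn : q != 0 by rewrite gt_eqF.
have [E [E3 Eb cE]] := random_deletion M triples (set0_notin_bad_configs k).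
exists E; split; last 1 first.
- rewrite cT -(ltr_nat rat) natrM natrX natrM -/q.
  have w : \sum_(J in bad_configs k) q^-1 ^+ #|J| <= 8 / 45 * q ^+ 2 + dense_const k * q.
    apply: le_trans (lerD star_weight (dense_weight k)).
    have w0 (J : {set {set T}}) : 0 <= q^-1 ^+ #|J| by rewrite exprn_ge0 // invr_ge0 ltW.
    apply: le_trans (lerD (sum_exists_le star_config w0) (sum_exists_le (dense_config k) w0)).
    rewrite [leLHS](bigID (fun J => [exists p, star_config p J])) /= lerD //.
      by rewrite le_eqVlt; apply/orP; left; apply/eqP/eq_bigl => J; rewrite inE; case: [exists p, star_config p J]; rewrite ?andbF.
    rewrite [leLHS]big_mkcond [leRHS]big_mkcond /=; apply: ler_sum => J _.
    rewrite inE; case: [exists p, star_config p J]; rewrite ?andbF ?andbT //=.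
    by case: ifP.
  have c3 : 8 * q ^+ 3 - 12 * q ^+ 2 <= 6 * #|triples|%:R.
    rewrite /triples card_draws cT.
    have : ('C(2 * M.+1, 3) * 6 = (2 * M.+1) * ((2 * M.+1).-1 * (2 * M.+1).-2))%N.
      by rewrite -[6%N]/(3`!) bin_ffact !ffactnS ffactn0 muln1.
    move/(congr1 (fun n => n%:R : rat)); cbv beta.
    have -> : ((2 * M.+1).-1 = (2 * M).+1)%N by lia.
    rewrite [(2 * M).+1.-1]/=.
    rewrite !natrM -(natr1 (2 * M)%N) natrM /q -(natr1 M).
    have : 0 <= M%:R :> rat by rewrite ler0n.
    lra.
  have {}c3 : 4 / 3 * q ^+ 2 - 2 * q <= #|triples|%:R / q.
    rewrite ler_pdivlMr //; lra.
  rewrite -/q in cE.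
  have {}cE := le_trans (lerB c3 w) cE.
  (* The spare quadratic term is [(4/3 - 8/45 - 1) * q ^+ 2 = 7/45 * q ^+ 2], so any factor of at
     least 45/7 in place of 10 absorbs the linear terms. *)
  have : 10 * (dense_const k + 2) * q < q * q by rewrite ltr_pM2r.
  have : 0 < q ^+ 2 by rewrite exprn_gt0.
  move: cE; move: q (dense_const k) (#|E|%:R) => z K e; lra.
- by move=> e /(fintype.subsetP E3); rewrite inE => /eqP.
- exact: avoid_sparse Eb.
- exact: avoid_codegree Eb.
Qed.
End Existence.

Lemma sparse_hypergraph k : exists t (E : {set {set 'I_t}}),
  [/\ (0 < t)%N, forall e, e \in E -> #|e| = 3%N, sparse_on k E, codegree_le 5 E & (t ^ 2 < 4 * #|E|)%N].
Proof.
have [M hM] : exists M : nat, 10 * (dense_const k + 2) < M.+1%:R.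
  have K0 : 0 <= 10 * (dense_const k + 2).
    by rewrite mulr_ge0 // addr_ge0 // sumr_ge0 // => s _; rewrite ler0n.
  exists (Num.bound (10 * (dense_const k + 2))).
  by apply: lt_le_trans (archi_boundP K0) _; rewrite ler_nat.
have [E [h1 h2 h3 h4]] := @sparse_subset 'I_(2 * M.+1) M (card_ord _) k hM.
by exists (2 * M.+1)%N, E; split=> //; rewrite -{1}(card_ord (2 * M.+1)).
Qed.

(** * Turan densities *)

(* [finfun.family] and [vector.free] shadow the definitions of [Defs]. *)
Import Pilot.Defs.

Definition homomorphic (G H : threegraph) : Prop :=
  exists c : vertices G -> vertices H, forall e, e \in edges G -> c @: e \in edges H.

(** The 3-graphs free of this family are exactly those homomorphic to [H], that is, the subgraphs of
    blow-ups of [H]. *)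
Definition non_homomorphic (H : threegraph) : family := fun G => ~ homomorphic G H.

Lemma card3_edges (H : threegraph) e : e \in edges H -> #|e| = 3%N.
Proof. by move=> eH; have /forall_inP/(_ e eH)/eqP := edges_uniform H. Qed.

(** In a complete 3-graph with more vertices than [H], two vertices get the same image, and an edge
    through both cannot map to a 3-element set. *)
Lemma non_homomorphic_inhab (H : threegraph) : exists G, non_homomorphic H G.
Proof.
pose n := #|vertices H|.+3.
pose E := [set e : {set 'I_n} | #|e| == 3%N].
have u : uniform3 E by apply/forall_inP => e; rewrite inE.
exists (ThreeGraph u) => -[/= c hc].
have : ~~ injectiveb c.
  apply/negP => /injectiveP/leq_card; rewrite card_ord /n; lia.
case/injectivePn => a [b ab cab].
have [d] : exists d, d \in ~: [set a; b].
  apply/card_gt0P; have := cardsC [set a; b]; rewrite card_ord cards2 ab /n; lia.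
rewrite !inE negb_or => /andP[da db].
have /hc/card3_edges : d |: [set a; b] \in E by rewrite inE cardsU1 cards2 !inE negb_or da db ab.
rewrite imsetU1 imsetU1 imset_set1 cab finset.setUid => h.
by have [+ _] := leq_card_setU [set c d] [set c b]; rewrite h !cards1.
Qed.

Lemma ex_free n (F : family) (E : {set {set 'I_n}}) (u : uniform3 E) :
  free F (ThreeGraph u) -> (#|E| <= ex n F)%N.
Proof. by move=> h; apply: (leq_bigmax_cond E); apply/asboolP; exists u. Qed.

Lemma ex_ind n (F : family) (P : nat -> Prop) : P 0%N ->
  (forall (E : {set {set 'I_n}}) (u : uniform3 E), free F (ThreeGraph u) -> P #|E|) -> P (ex n F).
Proof.
move=> P0 PE; rewrite /ex; elim/big_ind: _ => // [a b Pa Pb|E /asboolP[u /PE//]].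
by rewrite /maxn; case: ifP.
Qed.

(* Averaging over the [n + 1] induced subgraphs obtained by deleting one vertex. *)
Lemma ex_averaging n (F : family) : ((n.+1 - 3) * ex n.+1 F <= n.+1 * ex n F)%N.
Proof.
apply: (@ex_ind _ _ (fun x => ((n.+1 - 3) * x <= n.+1 * ex n F)%N)) => [|E u hE]; first by rewrite muln0.
pose Ev (v : 'I_n.+1) := [set e : {set 'I_n} | lift v @: e \in E].
have cEv v : (#|[set e in E | v \notin e]| <= ex n F)%N.
  have uv : uniform3 (Ev v).
    apply/forall_inP => e; rewrite inE => /(forall_inP u).
    by rewrite card_imset //; apply: lift_inj.
  apply: (@leq_trans #|Ev v|); last first.
    apply: (ex_free (u := uv)) => G FG [f [fi fe]]; apply: (hE G FG).
    exists (fun x => lift v (f x)); split; first by move=> x y /lift_inj/fi.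
    by move=> e /fe; rewrite inE -imset_comp.
  have sub : [set e in E | v \notin e] \subset [set lift v @: e | e : {set 'I_n} in Ev v].
    apply/fintype.subsetP => e; rewrite inE => /andP[eE ve]; apply/imsetP.
    have ee : lift v @: (lift v @^-1: e) = e.
      apply/setP => w; apply/imsetP/idP => [[w' + ->]|we]; first by rewrite inE.
      case: (unliftP v w) => [w' ww'|wv]; last by rewrite wv (negbTE ve) in we.
      by exists w' => //; rewrite inE -ww'.
    by exists (lift v @^-1: e) => //; rewrite inE ee.
  exact: leq_trans (subset_leq_card sub) (leq_imset_card _ _).
(* Double counting: each edge survives the deletion of any of the [n.+1 - 3] vertices outside it. *)
have -> : ((n.+1 - 3) * #|E| = \sum_v #|[set e in E | v \notin e]|)%N.
  under eq_bigr => v _ do rewrite -sum1_card.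
  transitivity (\sum_(v : 'I_n.+1) \sum_(e in E) (v \notin e : nat))%N; last first.
    apply: eq_bigr => v _; rewrite [RHS](eq_bigl (fun e => (e \in E) && (v \notin e))).
      by rewrite -big_mkcondr /=.
    by move=> e; rewrite inE.
  rewrite exchange_big /= -sum1_card big_distrr /=; apply: eq_bigr => e eE.
  rewrite muln1 -{1}(card_ord n.+1) -(cardsC e) (eqP (forall_inP u e eE)).
  rewrite addKn -sum1_card big_mkcond /=; apply: eq_bigr => v _.
  by rewrite inE; case: (v \in e).
rewrite -[X in (_ <= X * _)%N](card_ord n.+1) -sum_nat_const.
exact: leq_sum.
Qed.

(** * Monotonicity and convergence of the density sequence *)

Section Density.
Variables (R : realType) (F : family).

Let a (n : nat) : R := (ex n F)%:R / 'C(n, 3)%:R.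

(** [ex_averaging] divided by binomials. Below 3 the binomial is 0 and the quotient is 0 by
    convention, so monotonicity starts at 3. *)
Lemma density_nonincreasing n m : (3 <= n)%N -> (n <= m)%N -> a m <= a n.
Proof.
move=> n3; elim: m => [|m IH]; first by rewrite leqn0 => /eqP ->.
rewrite leq_eqVlt => /predU1P[-> //|]; rewrite ltnS => nm.
apply: le_trans (IH nm); have m3 := leq_trans n3 nm.
have C0 : (0 < 'C(m, 3))%N by rewrite bin_gt0.
have C1 : (0 < 'C(m.+1, 3))%N by rewrite bin_gt0 ltnW.
rewrite /a ler_pdivrMr ?ltr0n // mulrAC ler_pdivlMr ?ltr0n // -!natrM ler_nat.
have h := ex_averaging m F.
have hb : (m.+1 * 'C(m, 3) = (m.+1 - 3) * 'C(m.+1, 3))%N by rewrite mul_bin_down.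
rewrite -(@leq_pmul2l (m.+1 - 3)); last by rewrite subn_gt0 ltnS.
rewrite mulnA; apply: leq_trans (leq_mul h (leqnn _)) _.
by rewrite mulnAC hb -mulnA [('C(_, _) * _)%N]mulnC.
Qed.

Lemma density_cvg : cvgn a.
Proof.
pose b : nat -> R := fun n => a (n + 3)%N.
have bcvg : cvgn b.
  apply: nonincreasing_is_cvgn.
    by move=> n m nm; apply: density_nonincreasing; rewrite ?leq_addl ?leq_add2r.
  by exists 0 => _ [n _ <-]; rewrite /b /a divr_ge0 ?ler0n.
by move/cvg_ex: bcvg => [l]; rewrite /b (cvg_shiftn 3 a) => /cvgP.
Qed.

Lemma turan_density_le n : (3 <= n)%N -> turan_density R F <= a n.
Proof.
move=> n3; apply: limr_le density_cvg _.
by exists n => // m /= nm; apply: density_nonincreasing.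
Qed.

(** By monotonicity a bound at arbitrarily large [m] holds at every [n >= 3]; blow-ups of special
    sizes are thus enough. *)
Lemma turan_density_ge b : (forall n, exists2 m, (n <= m)%N & b <= a m) -> b <= turan_density R F.
Proof.
move=> h; apply: limr_ge density_cvg _.
exists 3%N => // n /= n3; have [m nm bm] := h n.
exact: le_trans bm (density_nonincreasing n3 nm).
Qed.
End Density.

(** * Edge counts of blow-ups *)

Section Fibers.
Variables (W V : finType) (c : W -> V).

Lemma card_fiber3 (h : {set V}) : #|h| = 3%N ->
  #|[set e : {set W} | (#|e| == 3%N) && (c @: e == h)]| = (\prod_(v in h) #|[set w | c w == v]|)%N.
Proof.
move=> h3; have /card_gt0P[p ph] : (0 < #|h|)%N by rewrite h3.
have h2 : #|h :\ p| == 2%N by apply/eqP/succn_inj; rewrite -h3 (cardsD1 p h) ph.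
have /cards2P[q [r [qr hE]]] := h2.
have : p \notin [set q; r] by rewrite -hE !inE eqxx.
have {}hE : h = p |: [set q; r] by rewrite -hE finset.setD1K.
rewrite !inE negb_or => /andP[pq pr].
pose f v := [set w | c w == v].
have fE w v : (w \in f v) = (c w == v) by rewrite inE.
rewrite hE big_setU1 ?inE ?negb_or ?pq ?pr //= big_setU1 ?inE //= big_set1 -/(f p) -/(f q) -/(f r).
rewrite -!cardsX.
(* [g] is a bijection from the product of the fibres over [p], [q], [r] to the counted sets; it is
   injective because these fibres are disjoint. *)
pose g (t : W * (W * W)) := t.1 |: [set t.2.1; t.2.2].
rewrite -(card_in_imset (f := g)); last first.
  move=> [a [b d]] [a' [b' d']]; rewrite !inE /= => /and3P[/eqP ca /eqP cb /eqP cd].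
  move=> /and3P[/eqP ca' /eqP cb' /eqP cd'] /setP gg.
  have /esym := gg a; rewrite !inE eqxx /= => /or3P[/eqP aa|/eqP ab|/eqP ad].
  2: by move: pq; rewrite -ca ab cb' eqxx.
  2: by move: pr; rewrite -ca ad cd' eqxx.
  have /esym := gg b; rewrite !inE eqxx orbT /= => /or3P[/eqP ba|/eqP bb|/eqP bd].
  1: by move: pq; rewrite -cb ba ca' eqxx.
  2: by move: qr; rewrite -cb bd cd' eqxx.
  have /esym := gg d; rewrite !inE eqxx !orbT /= => /or3P[/eqP da|/eqP db|/eqP dd].
  - by move: pr; rewrite -cd da ca' eqxx.
  - by move: qr; rewrite -cd db cb' eqxx.
  by rewrite aa bb dd.
apply: eq_card => e; rewrite inE; apply/andP/imsetP => [[/eqP e3 /eqP eh]|[[a [b d]] + ->]].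
  have pre v : v \in p |: [set q; r] -> exists2 w, w \in e & c w = v.
    by rewrite -eh => /imsetP[w we ->]; exists w.
  have [a ae ca] := pre p ltac:(by rewrite !inE eqxx).
  have [b be cb] := pre q ltac:(by rewrite !inE eqxx !orbT).
  have [d de cd] := pre r ltac:(by rewrite !inE eqxx !orbT).
  exists (a, (b, d)); first by rewrite !inE /= ca cb cd !eqxx.
  apply/esym/eqP; rewrite eqEcard; apply/andP; split.
    by rewrite /g /= !finset.subUset !finset.sub1set ae be de.
  rewrite e3 /g /= cardsU1 cards2 !inE negb_or.
  have -> : a != b by apply: contraNneq pq => ab; rewrite -ca -cb ab.
  have -> : a != d by apply: contraNneq pr => ab; rewrite -ca -cd ab.
  by have -> : b != d by apply: contraNneq qr => ab; rewrite -cb -cd ab.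
rewrite !inE /= => /and3P[/eqP ca /eqP cb /eqP cd]; split.
  rewrite /g /= cardsU1 cards2 !inE negb_or.
  have -> : a != b by apply: contraNneq pq => ab; rewrite -ca -cb ab.
  have -> : a != d by apply: contraNneq pr => ab; rewrite -ca -cd ab.
  by have -> : b != d by apply: contraNneq qr => ab; rewrite -cb -cd ab.
by rewrite /g /= !imsetU1 imset_set1 ca cb cd.
Qed.

Lemma card_hom_edges (E : {set {set V}}) : uniform3 E ->
  #|[set e : {set W} | (#|e| == 3%N) && (c @: e \in E)]| =
  (\sum_(h in E) \prod_(v in h) #|[set w | c w == v]|)%N.
Proof.
move=> u; rewrite -sum1_card (partition_big (fun e : {set W} => c @: e) (mem E)) /=; last first.
  by move=> e; rewrite inE => /andP[].
apply: eq_bigr => h hE; rewrite -card_fiber3 ?(eqP (forall_inP u h hE)) // -sum1_card.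
apply: eq_bigl => e; rewrite !inE; case: (c @: e =P h) => [->|]; last by rewrite !andbF.
by rewrite hE !andbT.
Qed.
End Fibers.

(** The Lagrange polynomial of the 3-graph. *)
Definition edge_poly (R : realFieldType) (V : finType) (E : {set {set V}}) (x : V -> R) : R :=
  \sum_(h in E) \prod_(v in h) x v.

(** The left side counts the edges of the blow-up with parts the fibres of [c]. Everything it
    contains is homomorphic to [H] through [c]. *)
Lemma ex_homomorphic_ge (H : threegraph) (W : finType) (c : W -> vertices H) :
  (\sum_(h in edges H) \prod_(v in h) #|[set w | (c w == v)%B]| <= ex #|W| (non_homomorphic H))%N.
Proof.
pose c' (i : 'I_#|W|) := c (enum_val i).
have -> : (\sum_(h in edges H) \prod_(v in h) #|[set w | c w == v]| =
    \sum_(h in edges H) \prod_(v in h) #|[set i | c' i == v]|)%N.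
  apply: eq_bigr => h _; apply: eq_bigr => v _.
  have -> : [set w | c w == v] = enum_val @: [set i | c' i == v].
    apply/setP => w; rewrite inE; apply/idP/imsetP => [cw|[i + ->]]; last by rewrite inE.
    by exists (enum_rank w); rewrite ?inE /c' enum_rankK.
  by rewrite card_imset //; apply: enum_val_inj.
rewrite -card_hom_edges ?edges_uniform //.
set E := [set e | _].
have u : uniform3 E by apply/forall_inP => e; rewrite inE => /andP[].
apply: (ex_free (u := u)) => G FG [f [fi fe]]; apply: FG.
exists (fun x => c' (f x)) => e /fe; rewrite inE => /andP[_].
by rewrite -imset_comp.
Qed.

(** A free 3-graph contains itself, hence is homomorphic to [H]. It lies in the blow-up given by the
    fibres, whose relative sizes serve as the weights [x]. *)
Lemma ex_homomorphic_le (R : realFieldType) (H : threegraph) (n : nat) (L : R) :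
  (0 < n)%N -> 0 <= L ->
  (forall x : vertices H -> R, (forall v, 0 <= x v) -> \sum_v x v = 1 ->
     6 * edge_poly (edges H) x <= L) ->
  6 * (ex n (non_homomorphic H))%:R <= L * n%:R ^+ 3.
Proof.
move=> n0 L0 hL.
have nn : n%:R != 0 :> R by rewrite pnatr_eq0 -lt0n.
apply: (@ex_ind _ _ (fun m => 6 * m%:R <= L * n%:R ^+ 3)) => [|E u hE].
  by rewrite mulr0 mulr_ge0 ?exprn_ge0 ?ler0n.
have [c hc] : homomorphic (ThreeGraph u) H.
  apply: contrapT => nh; apply: (hE _ nh); exists id; split=> // e eE.
  by rewrite imset_id.
pose x v : R := #|[set w | c w == v]|%:R / n%:R.
have x0 v : 0 <= x v by rewrite divr_ge0 ?ler0n.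
have x1 : \sum_v x v = 1.
  rewrite -mulr_suml -natr_sum (_ : (\sum_v _ = n)%N) ?divff //.
  rewrite -[RHS](card_ord n) -[RHS]sum1_card (partition_big c predT) //=.
  by apply: eq_bigr => v _; rewrite -sum1_card; apply: eq_bigl => w; rewrite inE.
rewrite -ler_pdivrMr ?exprn_gt0 ?ltr0n // -mulrA.
apply: le_trans (hL x x0 x1); rewrite ler_wpM2l // ler_pdivrMr ?exprn_gt0 ?ltr0n //.
have -> : edge_poly (edges H) x * n%:R ^+ 3 =
    (\sum_(h in edges H) \prod_(v in h) #|[set w | c w == v]|)%:R.
  rewrite mulr_suml natr_sum; apply: eq_bigr => h hH.
  rewrite /x big_split /= prodr_const (card3_edges hH) natr_prod -mulrA -exprMn mulVf //.
  by rewrite expr1n mulr1.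
rewrite ler_nat -card_hom_edges ?edges_uniform //.
apply/subset_leq_card/fintype.subsetP => e eE.
by rewrite inE (forall_inP u e eE) hc.
Qed.

(** * The pattern 3-graph; [None] is its vertex 0 *)

Section Pattern.
Variable T : finType.

Definition pairs : {set {set T}} := [set p : {set T} | #|p| == 2%N].

Definition pattern_edges (E : {set {set T}}) : {set {set option T}} :=
  [set None |: (Some @: (p : {set T})) | p in pairs] :|: [set Some @: (e : {set T}) | e in E].

Lemma notin_Some (p : {set T}) : None \notin [set Some x | x in p].
Proof. by apply/imsetP => -[]. Qed.

Lemma pattern_uniform (E : {set {set T}}) : (forall e, e \in E -> #|e| = 3%N) ->
  uniform3 (pattern_edges E).
Proof.
move=> E3; apply/forall_inP => e /setUP[/imsetP[p + ->]|/imsetP[e' eE ->]].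
  rewrite inE => /eqP p2.
  by rewrite cardsU1 notin_Some card_imset ?p2 //; apply: Some_inj.
by rewrite card_imset ?E3 //; apply: Some_inj.
Qed.

Variable R : realFieldType.

Lemma sum_pairs (g : T -> R) : 2 * \sum_(p in pairs) \prod_(v in p) g v =
  (\sum_v g v) ^+ 2 - \sum_v g v ^+ 2.
Proof.
have := sum_offdiag [set: T] g.
rewrite !(eq_bigl _ _ (fun v => finset.in_setT v)) => <-.
rewrite pair_big_dep /= (partition_big (fun t : T * T => [set t.1; t.2]) (mem pairs)) /=; last first.
  by move=> [a b] /andP[_ /= ba]; rewrite inE cards2 (eq_sym a) ba.
rewrite mulr_sumr; apply: eq_bigr => p pp.
rewrite -sum_offdiag2; last by move: pp; rewrite inE => /eqP.
rewrite pair_big_dep /=; apply: eq_bigl => -[a b] /=.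
rewrite !inE /=; apply/idP/idP => [/and3P[ap bp ba]|/andP[ba /eqP <-]]; last first.
  by rewrite !inE !eqxx orbT ba.
have p2 : #|p| = 2%N by move: pp; rewrite inE => /eqP.
rewrite ba eqEcard p2 cards2 (eq_sym a) ba /= andbT.
by rewrite finset.subUset !finset.sub1set ap.
Qed.

Lemma edge_poly_pattern (E : {set {set T}}) (z : option T -> R) :
  6 * edge_poly (pattern_edges E) z =
  3 * z None * ((\sum_v z (Some v)) ^+ 2 - \sum_v z (Some v) ^+ 2) +
  6 * edge_poly E (fun v => z (Some v)).
Proof.
have imI : injective (fun e : {set T} => Some @: e) by apply: imset_inj; apply: Some_inj.
rewrite -sum_pairs /edge_poly /pattern_edges.
set P2 := [set None |: _ | p in _]; set P3 := [set Some @: _ | e in _].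
rewrite (eq_bigl (mem [predU P2 & P3])); last by move=> e; rewrite /= !inE.
(* The two kinds of edges are told apart by whether they contain [None]. *)
rewrite bigU /=; last first.
  rewrite -finset.setI_eq0; apply/eqP/setP => e; rewrite !inE; apply/negP => /andP[/imsetP[p _ ->]].
  by case/imsetP => e' _ /setP/(_ None); rewrite !inE eqxx /= (negbTE (notin_Some _)).
rewrite /P2 /P3.
rewrite [X in 6 * (X + _)]big_imset /=; last first.
  move=> p q _ _ /(congr1 (fun e => e :\ None)); rewrite !finset.setU1K ?notin_Some //; exact: imI.
rewrite [X in 6 * (_ + X)]big_imset /=; last by move=> p q _ _; exact: imI.
have P (e : {set T}) : \prod_(v in Some @: e) z v = \prod_(v in e) z (Some v).
  by rewrite big_imset //= => a b _ _ [].
under eq_bigr => p _ do rewrite big_setU1 ?notin_Some //= P.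
under [X in 6 * (_ + X)]eq_bigr => e _ do rewrite P.
rewrite -mulr_sumr; ring.
Qed.
End Pattern.

Lemma ffact3_le n : (6 * 'C(n, 3) <= n ^ 3)%N.
Proof. by rewrite mulnC; apply: bin_fact_le_exp. Qed.

(** * Density of the pattern from below and from above *)

Section Main.
Variables (R : realType) (t : nat) (E : {set {set 'I_t}}).
Hypothesis t0 : (0 < t)%N.
Hypothesis E3 : forall e, e \in E -> #|e| = 3%N.

Definition pattern : threegraph := ThreeGraph (pattern_uniform E3).

Lemma pattern_density_gt : (t ^ 2 < 4 * #|E|)%N ->
  4 / 9 < turan_density R (non_homomorphic pattern).
Proof.
move=> tE.
(* The value of the polynomial at weight 1/3 on [None] and [2 / (3 * t)] on every other vertex. *)
pose b : R := (12 * t%:R ^+ 3 - 12 * t%:R ^+ 2 + 48 * #|E|%:R) / (27 * t%:R ^+ 3).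
have tp : 0 < t%:R :> R by rewrite ltr0n.
have t3 : 0 < 27 * t%:R ^+ 3 :> R by rewrite mulr_gt0 ?exprn_gt0.
apply: (@lt_le_trans _ _ b).
  rewrite /b ltr_pdivlMr //.
  have : t%:R ^+ 2 < 4 * #|E|%:R :> R by rewrite -natrX -natrM ltr_nat.
  lra.
apply: turan_density_ge => n0; pose m := n0.+1.
(* These weights realised by part sizes: [t * m] for [None] and [2 * m] for each other vertex, out
   of [3 * t * m]. *)
pose W : finType := (('I_t * 'I_(2 * m)) + 'I_(t * m))%type.
pose c (w : W) : option 'I_t := match w with inl p => Some p.1 | inr _ => None end.
have cW : #|{: W}| = (3 * (t * m))%N by rewrite card_sum card_prod !card_ord; lia.
exists #|{: W}|; first by rewrite cW /m; nia.
have C0 : (0 < 'C(#|{: W}|, 3))%N by rewrite bin_gt0 cW /m; nia.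
rewrite ler_pdivlMr ?ltr0n //.
have := @ex_homomorphic_ge pattern W c; rewrite -(ler_nat R); apply: le_trans.
have -> : (\sum_(h in edges pattern) \prod_(v in h) #|[set w | c w == v]|)%:R =
    edge_poly (pattern_edges E) (fun v => #|[set w | c w == v]|%:R : R).
  by rewrite natr_sum; apply: eq_bigr => h _; rewrite natr_prod.
rewrite -(ler_pM2l (ltr0n R 6)) edge_poly_pattern.
have cS i : #|[set w | c w == Some i]| = (2 * m)%N.
  rewrite -[RHS]card_ord -cardsT -(card_imset _ (f := fun j => inl (i, j) : W)); last by move=> j j' [].
  apply: eq_card => -[[i' j]|j]; rewrite !inE /=.
    apply/eqP/imsetP => [[->]|[j' _ [-> _]] //]; by exists j.
  by apply/esym/imsetP => -[].
have cN : #|[set w | c w == None]| = (t * m)%N.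
  rewrite -[RHS]card_ord -cardsT -(card_imset _ (f := fun j => inr j : W)); last by move=> j j' [].
  apply: eq_card => -[[i' j]|j]; rewrite !inE /=.
    by apply/esym/imsetP => -[].
  by apply/esym/imsetP; exists j; rewrite ?inE.
under eq_bigr => i _ do rewrite cS.
under [X in _ - X]eq_bigr => i _ do rewrite cS.
rewrite !sumr_const card_ord cN /edge_poly.
have -> : \sum_(h in E) \prod_(v in h) (#|[set w | c w == Some v]|%:R : R) = #|E|%:R * (2 * m)%:R ^+ 3.
  rewrite (eq_bigr (fun _ => (2 * m)%:R ^+ 3)) ?sumr_const ?mulr_natl // => h hE.
  by rewrite (eq_bigr (fun _ => (2 * m)%:R)) ?prodr_const ?E3 // => v _; rewrite cS.
have h6 : 6 * 'C(#|{: W}|, 3)%:R <= 27 * t%:R ^+ 3 * m%:R ^+ 3 :> R.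
  have := ffact3_le #|{: W}|; rewrite -(ler_nat R) natrM => /le_trans; apply.
  by rewrite cW !natrX !natrM; lra.
have b0 : 0 <= b.
  rewrite /b divr_ge0 ?(ltW t3) //.
  have : (t ^ 2 <= t ^ 3)%N by rewrite leq_pexp2l.
  rewrite -(ler_nat R) !natrX => h.
  by have := ler0n R #|E|; lra.
apply: (@le_trans _ _ (b * (27 * t%:R ^+ 3 * m%:R ^+ 3))).
  by rewrite mulrCA ler_wpM2l.
rewrite [b * _]mulrA /b divfK ?gt_eqF // -[(2 * m)%:R *+ t]mulr_natl -[(2 * m)%:R ^+ 2 *+ t]mulr_natl !natrM; lra.
Qed.

(** Half of the error [30 * delta] comes from [sparse_pattern_bound]; the other half pays for
    replacing [n ^ 3] by [6 * 'C(n, 3)] at a single large [n]. *)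
Lemma pattern_density_le (k : nat) (delta : R) : sparse_on k E -> codegree_le 5 E ->
  0 < delta -> 1 <= k%:R * delta ->
  turan_density R (non_homomorphic pattern) <= 4 / 9 + 30 * delta.
Proof.
move=> Esp Ecod d0 kd.
pose L : R := 4 / 9 + 15 * delta.
have L0 : 0 <= L by rewrite /L; lra.
(* [n] is large enough that the loss [3 * n ^ 2] in [n * (n - 1) * (n - 2)], times the final bound,
   is at most [15 * delta * n ^ 3]. *)
pose N := Num.bound (3 * (4 / 9 + 30 * delta) / (15 * delta)); pose n := N.+3.
apply: le_trans (turan_density_le R (non_homomorphic pattern) (isT : (3 <= n)%N)) _.
have C0 : (0 < 'C(n, 3))%N by rewrite bin_gt0.
rewrite ler_pdivrMr ?ltr0n // -(ler_pM2l (ltr0n R 6)).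
apply: le_trans (ex_homomorphic_le (H := pattern) (L := L) _ L0 _) _ => //.
  move=> x x0 x1; rewrite edge_poly_pattern.
  have xs : \sum_v x (Some v) = 1 - x None.
    rewrite -x1 (bigD1 None) //= addrC addrK.
    rewrite (reindex_omap Some id) /=; last by case.
    by apply: eq_bigl => v; rewrite eqxx.
  have := @sparse_pattern_bound R _ k delta E (fun v => x (Some v)) E3 Esp Ecod _ _ d0 kd.
  rewrite xs subKr; apply => //.
  by rewrite lerBlDr lerDl.
have c6 : 6 * 'C(n, 3)%:R = n%:R * ((n%:R - 1) * (n%:R - 2)) :> R.
  have : ('C(n, 3) * 6 = n * (n.-1 * n.-2))%N by rewrite -[6%N]/(3`!) bin_ffact !ffactnS ffactn0 muln1.
  move/(congr1 (fun j => j%:R : R)); rewrite !natrM mulrC => ->.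
  by rewrite /n /= -(natr1 N.+2) -(natr1 N.+1) -(natr1 N); ring.
rewrite [leRHS]mulrCA c6.
have n3 : 3 <= n%:R :> R by rewrite ler_nat.
have nb : 3 * (4 / 9 + 30 * delta) <= n%:R * (15 * delta).
  rewrite -ler_pdivrMr ?mulr_gt0 //.
  apply: le_trans (ltW (archi_boundP _)) _; last by rewrite ler_nat; exact: leq_addl 3 N.
  by rewrite divr_ge0 // ?mulr_ge0 ?addr_ge0 // ?mulr_ge0 // ltW.
move: (n%:R : R) n3 nb => x n3 nb.
have x0 : 0 <= x by lra.
have : x * (x * (3 * (4 / 9 + 30 * delta))) <= x * (x * (x * (15 * delta))) by rewrite !ler_wpM2l.
have : 0 <= x * (2 * (4 / 9 + 30 * delta)) by rewrite mulr_ge0 //; lra.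
rewrite /L; lra.
Qed.
End Main.

Theorem theorem1p1 (R : realType) : non_jump (4 / 9 : R).
Proof.
split; first by apply/andP; split; lra.
move=> [c c0 hc].
(* With [delta = c / 60] the upper bound is [4/9 + c/2], strictly inside the interval. *)
pose k := Num.bound (60 / c).
have kd : 1 <= k%:R * (c / 60).
  have h : 60 / c < k%:R by apply: archi_boundP; rewrite divr_ge0 // ltW.
  rewrite -ler_pdivrMr ?divr_gt0 //; apply: le_trans (ltW h).
  by rewrite invf_div mul1r.
have [t [E [t0 E3 Esp Ecod tE]]] := sparse_hypergraph k.
pose F := non_homomorphic (pattern E3).
have : (@Pi_infty R `&` `]4 / 9, (4 / 9 + c)[)%classic (turan_density R F).
  split; first by exists F; split=> //; apply: non_homomorphic_inhab.
  rewrite /= in_itv /= pattern_density_gt //=.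
  apply: le_lt_trans (pattern_density_le E3 Esp Ecod _ kd) _; first by rewrite divr_gt0.
  lra.
by rewrite hc.
Qed.
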